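(* Let $g\in\mathcal{F}$, and assume that for every $L_0\in\mathbb{R}$ a minimizer of $\|K(g-f)\|$ subject to $Lf=L_0$ and $f\in\mathcal{F}$ exists. Assume in addition that $\mathcal{F}$ is centrosymmetric and that $f-g\in\mathcal{F}$ for all $f\in\mathcal{F}$. Then the efficiency at $g$ of the fixed-length confidence interval around $\hat L_{\delta_\chi,\mathcal{F}}$, relative to all confidence sets, is $$\frac{\inf_{\mathcal{C}\in\mathcal{I}_\alpha}E_g\lambda(\mathcal{C}(Y))}{2\chi_\alpha(\hat L_{\delta_\chi,\mathcal{F}})}=\frac{(1-\alpha)\,E\left[\omega(2\sigma(z_{1-\alpha}-Z);\mathcal{F})\mid Z\le z_{1-\alpha}\right]}{2\,\mathrm{cv}_\alpha\left(\frac{\omega(\delta_\chi;\mathcal{F})}{2\sigma\omega'(\delta_\chi;\mathcal{F})}-\frac{\delta_\chi}{2\sigma}\right)\cdot\sigma\,\omega'(\delta_\chi;\mathcal{F})},$$ where $Z$ is a standard normal random variable.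
   Context: Model: one observes $Y=Kf+\sigma\varepsilon$, where $f$ is known to lie in a convex subset $\mathcal{F}$ of a vector space, $K$ is a known linear operator from (the span of) $\mathcal{F}$ to a real Hilbert space $\mathcal{Y}$ with inner product $\langle\cdot,\cdot\rangle$ and norm $\|\cdot\|$, $\sigma>0$ is known, and $\varepsilon$ is standard Gaussian: for each $h\in\mathcal{Y}$, $\langle\varepsilon,h\rangle\sim\mathcal{N}(0,\|h\|^2)$. $L$ is a linear functional; the parameter of interest is $Lf$. $P_f,E_f$ denote probability and expectation under $f$; $\alpha\in(0,1)$; $z_q$ is the $q$-quantile of the standard normal distribution; $\lambda$ is Lebesgue measure. $\mathcal{F}$ is centrosymmetric if $f\in\mathcal{F}\Rightarrow-f\in\mathcal{F}$. $\mathcal{I}_\alpha$ is the collection of (random) sets $\mathcal{C}=\mathcal{C}(Y)\subseteq\mathbb{R}$ with $\inf_{f\in\mathcal{F}}P_f(Lf\in\mathcal{C})\ge1-\alpha$. $\mathrm{cv}_\alpha(t)$ is the $1-\alpha$ quantile of $|\mathcal{N}(t,1)|$. Modulus: $\omega(\delta;\mathcal{F})=\sup\{Lg-Lf:\|K(g-f)\|\le\delta,\ f,g\in\mathcal{F}\}$, concave in $\delta$; $\omega'(\delta;\mathcal{F})$ denotes an element (the same throughout) of its superdifferential $\{d:\omega(\eta;\mathcal{F})\le\omega(\delta;\mathcal{F})+d(\eta-\delta)\ \forall\eta>0\}$, assumed nonzero. With $(f^*_\delta,g^*_\delta)$ a maximizing pair for $\omega(\delta;\mathcal{F})$ (assumed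 to exist) and $f^*_{M,\delta}=(f^*_\delta+g^*_\delta)/2$, $$\hat L_{\delta,\mathcal{F}}=Lf^*_{M,\delta}+\frac{\omega'(\delta;\mathcal{F})}{\delta}\langle K(g^*_\delta-f^*_\delta),Y-Kf^*_{M,\delta}\rangle.$$ The fixed-length confidence interval around $\hat L_{\delta,\mathcal{F}}$ is $\hat L_{\delta,\mathcal{F}}\pm\chi_\alpha(\hat L_{\delta,\mathcal{F}})$ with $$\chi_\alpha(\hat L_{\delta,\mathcal{F}})=\mathrm{cv}_\alpha\left(\frac{\omega(\delta;\mathcal{F})}{2\sigma\omega'(\delta;\mathcal{F})}-\frac{\delta}{2\sigma}\right)\sigma\,\omega'(\delta;\mathcal{F}),$$ and $\delta_\chi=\operatorname{argmin}_{\delta>0}\chi_\alpha(\hat L_{\delta,\mathcal{F}})$. *)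

(* Defs.v *)
From HB Require Import structures.
From mathcomp Require Import all_boot all_order all_algebra sesquilinear.
From mathcomp Require Import all_classical all_reals all_analysis.

Set Implicit Arguments.
Unset Strict Implicit.
Unset Printing Implicit Defensive.

Import Order.TTheory GRing.Theory Num.Theory.
Import numFieldNormedType.Exports.

Local Open Scope classical_set_scope.
Local Open Scope ring_scope.
Local Open Scope ereal_scope.

Definition quantile (R : realType) (mu : set R -> \bar R) (q : R) : R :=
  inf [set x : R | q%:E <= mu `]-oo, x]%classic].

Definition z_quantile (R : realType) (q : R) : R :=
  quantile (normal_prob (0%R : R) 1%R) q.

Definition cv (R : realType) (alpha t : R) : R :=
  quantile (pushforward (normal_prob t 1%R) (fun x : R => `|x|%R)) (1 - alpha)%R.

(* E[X | A] for an event A of positive probability. *)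
Definition cond_mean d (T : measurableType d) (R : realType)
    (P : probability T R) (A : set T) (X : T -> \bar R) : \bar R :=
  (\int[P]_(w in A) X w) / P A.

(* N(m, s^2). The library's normal_prob m 0 is the uniform law on [0, 1], so
   the degenerate case is treated apart. *)
Definition gaussian (R : realType) (m s : R) : set R -> \bar R :=
  if s == 0%R then \d_m else normal_prob m s.

(* The standard Gaussian noise is not in general an element of H; it is given
   by the random variables eps h, standing for <eps, h>, which depend linearly
   on h up to null sets. *)
Definition standard_gaussian (R : realType) (H : normedModType R) d
    (Omega : measurableType d) (P : probability Omega R)
    (eps : H -> {RV P >-> R}) : Prop :=
  (forall (h : H) (B : set R), measurable B ->
     distribution P (eps h) B = gaussian 0%R `|h|%R B) /\
  (forall (a : R) (h k : H),
     {ae P, forall w, eps (a *: h + k)%R w = (a * eps h w + eps k w)%R}).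

(* An observation y is identified with the map h |-> <y, h>; the sample space
   carries the sigma-algebra generated by these evaluations. *)
Definition cylinders (R : realType) (H : Type) : set (set (H -> R)) :=
  [set A | exists (h : H) (B : set R),
     measurable B /\ A = [set y : H -> R | B (y h)]].

Definition sample_space (R : realType) (H : Type) :=
  g_sigma_algebraType (@cylinders R H).

(* Y = K f + sigma eps *)
Definition observation (R : realType) (H : normedModType R)
    (ip : H -> H -> R) (V : lmodType R) (K : V -> H) (sigma : R) d
    (Omega : measurableType d) (P : probability Omega R)
    (eps : H -> {RV P >-> R}) (f : V) (w : Omega) : sample_space R H :=
  fun h => (ip (K f) h + sigma * eps h w)%R.

Section Model.
Context (R : realType) (V : lmodType R) (H : normedModType R).
Context (ip : H -> H -> R) (F : set V) (K : V -> H) (L : V -> R) (sigma : R).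

Definition modulus (delta : R) : \bar R :=
  ereal_sup [set (L p.2 - L p.1)%:E | p in
    [set p : V * V | (`|K (p.2 - p.1)| <= delta)%R /\ F p.1 /\ F p.2]].

Definition modulus_maximizer (delta : R) (f g : V) : Prop :=
  [/\ F f, F g, (`|K (g - f)| <= delta)%R &
      (L g - L f)%:E = modulus delta].

Definition superdifferential (w : R -> \bar R) (delta : R) : set R :=
  [set s | forall eta : R, (0 < eta)%R ->
     w eta <= w delta + (s * (eta - delta))%:E].

(* dw delta is the chosen superdifferential element, (fs, gs) the chosen
   maximizing pairs; <h, Y - K fM> is y h - <h, K fM>. *)
Definition Lhat (dw : R -> R) (fs gs : R -> V) (delta : R)
    (y : sample_space R H) : R :=
  let fM := (2^-1 *: (fs delta + gs delta))%R in
  let h := K (gs delta - fs delta)%R in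
  (L fM + dw delta / delta * (y h - ip h (K fM)))%R.

Definition chi (alpha : R) (dw : R -> R) (delta : R) : R :=
  (cv alpha (fine (modulus delta) / (2 * sigma * dw delta)
             - delta / (2 * sigma)) * (sigma * dw delta))%R.

Definition flci (alpha : R) (dw : R -> R) (fs gs : R -> V) (delta : R)
    (y : sample_space R H) : set R :=
  let l := Lhat dw fs gs delta y in
  `[(l - chi alpha dw delta)%R, (l + chi alpha dw delta)%R]%classic.

Context d (Omega : measurableType d) (P : probability Omega R).
Context (eps : H -> {RV P >-> R}).

Let Y := observation ip K sigma eps.

(* I_alpha; joint measurability makes the coverage probabilities and the
   expected Lebesgue measure meaningful. *)
Definition confidence_sets (alpha : R) : set (sample_space R H -> set R) :=
  [set C | measurable [set p : sample_space R H * R | C p.1 p.2] /\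
     (1 - alpha)%:E <= ereal_inf [set P [set w | C (Y f w) (L f)] | f in F]].

Definition expected_length (g : V) (C : sample_space R H -> set R) : \bar R :=
  \int[P]_w lebesgue_measure (C (Y g w)).

Definition best_expected_length (alpha : R) (g : V) : \bar R :=
  ereal_inf [set expected_length g C | C in confidence_sets alpha].

Definition efficiency (alpha : R) (g : V) (C : sample_space R H -> set R) :
    \bar R :=
  best_expected_length alpha g / expected_length g C.

End Model.

(* Main.v *)
Require Import Defs.
From HB Require Import structures.
From mathcomp Require Import all_boot all_order all_algebra sesquilinear.
From mathcomp Require Import all_classical all_reals all_analysis.
From mathcomp Require Import measurable_realfun.
From mathcomp Require Import ring lra.

Set Implicit Arguments.
Unset Strict Implicit.
Unset Printing Implicit Defensive.

Import Order.TTheory GRing.Theory Num.Theory.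
Import numFieldNormedType.Exports.

Local Open Scope classical_set_scope.
Local Open Scope ring_scope.
Local Open Scope ereal_scope.

(* By Pratt's identity the expected length at g of a confidence set C is the
   integral over theta of P_g(theta in C). Centring at g (F + g = F), let
   rho(theta) be the distance from K g to the image under K of
   {f in F : L f = theta}. The Neyman-Pearson lemma bounds P_g(theta in C) below
   by Phi(z - rho(theta) / sigma), and one-sided tests in the direction of the
   nearest point of the null attain the bound. By Tonelli's theorem the integral
   of Phi(z - rho / sigma) is the expectation over Z of the Lebesgue measure of
   {rho <= sigma (z - Z)}, which convexity and symmetry of F turn into
   modulus (2 sigma (z - Z)).

   The Neyman-Pearson bound needs the law of the whole process eps, of which
   only the one-dimensional marginals are given. The functions by which one may
   multiply test functions without destroying equality of two expectations form
   an algebra closed under bounded limits; it contains the cosines of evaluations,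
   hence sign(sin(t x)), hence sign(x), hence all measurable indicators. So the
   marginals determine the law, and eps may be replaced by its component
   orthogonal to a unit vector e plus e times an independent N(0, 1). *)

(** * Gaussian measures on the line *)

(** The upper bound is reached only up to an arbitrary excess. The nearest points [hs tau] are
    obtained by choice and need not depend measurably on [tau], so inverting the optimal tests one
    theta at a time need not give a jointly measurable set. Directions are therefore taken at
    rational values of [tau], and the loss of power at theta is controlled by [kappa] times an
    integrable weight. The points where rho vanishes cannot be discarded, since they may fill an
    interval; there the nearest null point has the same image under [K] as [g], and the accepting
    probability under [g] must be exactly 1 - alpha. For the lower bound, once the component of the
    noise orthogonal to the direction of the nearest null point is fixed, passing from the null to
    [g] only shifts one normal variable. The resulting inequality has a constant that does not
    depend on that component, so it can be integrated, and no density between laws on the sample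
    space is required. *)

Section gaussian_measures.
Context {R : realType}.
Implicit Types (a b m r s x y u : R) (B : set R).
Local Notation mu := (@lebesgue_measure R).

Lemma measurable_affine a b :
  measurable_fun [set: R] (fun x : R => (a * x + b)%R).
Proof. by apply: measurable_funD => //; exact: measurable_funM. Qed.

Lemma lebesgue_measure_affine a b B : a != 0%R -> measurable B ->
  (`|a|%:E * mu ((fun x : R => a * x + b)%R @^-1` B) = mu B)%E.
Proof.
move=> a0 mB; have na0 : (0 <= `|a|)%R by [].
pose f (x : measurableTypeR R) : measurableTypeR R := (a * x + b)%R.
have mf : measurable_fun setT f by exact: measurable_affine.
pose nu := mscale (NngNum na0)
  (measure_function_pushforward__canonical__measure_function_Measure mu mf).
suff: mu B = nu B by rewrite /nu /mscale/= => <-.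
apply: (@lebesgue_measure_unique R nu) => // _ [[c d]] _ <-.
rewrite -[RHS]/(`|a|%:E * mu (f @^-1` `]c, d]%classic)).
rewrite lebesgue_measure_itv/=.
have [a_gt0|a_lt0|a00] := ltrgt0P a; last by rewrite a00 eqxx in a0.
- rewrite (_ : _ @^-1` _ = `]((c - b) / a)%R, ((d - b) / a)%R]%classic); last first.
    apply/seteqP; split => x /=; rewrite /f !in_itv/= ltr_pdivrMr// ler_pdivlMr//;
      rewrite ltrBlDr lerBrDr; by rewrite mulrC.
  rewrite lebesgue_measure_itv/= !lte_fin ltr_pM2r ?invr_gt0// ltrD2r.
  by case: ifP => cd; rewrite ?mule0// -!EFinB -EFinM; congr EFin; field.
- rewrite (_ : _ @^-1` _ = `[((d - b) / a)%R, ((c - b) / a)%R[%classic); last first.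
    apply/seteqP; split => x /=; rewrite /f !in_itv/= ltr_ndivlMr// ler_ndivrMr//;
      rewrite ltrBlDr lerBrDr mulrC => /andP[? ?]; exact/andP.
  rewrite lebesgue_measure_itv/= !lte_fin ltr_nM2r ?invr_lt0// ltrD2r.
  by case: ifP => cd; rewrite ?mule0// -!EFinB -EFinM; congr EFin; field.
Qed.

Lemma ge0_integral_affine a b (f : R -> \bar R) : a != 0%R ->
  measurable_fun setT f -> (forall x, 0 <= f x) ->
  (`|a|%:E * \int[mu]_x f (a * x + b)%R = \int[mu]_x f x)%E.
Proof.
move=> a0 mf f0; have na0 : (0 <= `|a|)%R by [].
pose h (x : measurableTypeR R) : measurableTypeR R := (a * x + b)%R.
have mh : measurable_fun setT h by exact: measurable_affine.
pose nu := mscale (NngNum na0)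
  (measure_function_pushforward__canonical__measure_function_Measure mu mh).
rewrite (_ : \int[mu]_x f x = \int[nu]_x f x); last first.
  apply: eq_measure_integral => A mA _.
  by rewrite /nu /mscale/= /pushforward/=; exact/esym/lebesgue_measure_affine.
by rewrite ge0_integral_mscale//= ge0_integral_pushforward.
Qed.

Lemma normal_pdf_affine a b m s x : a != 0%R -> s != 0%R ->
  (`|a| * normal_pdf (a * m + b) (a * s) (a * x + b) = normal_pdf m s x)%R.
Proof.
move=> a0 s0; rewrite !normal_pdfE ?mulf_neq0// mulrA; congr (_ * _)%R.
  rewrite /normal_peak exprMn -!mulrnAr -mulrA sqrtrM ?sqr_ge0// sqrtr_sqr invfM.
  by rewrite mulrA divff ?normr_eq0// mul1r.
by rewrite /normal_fun; congr expR; field; rewrite a0 s0.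
Qed.

Lemma normal_probE m s B : measurable B ->
  normal_prob m s B = \int[mu]_x ((normal_pdf m s x)%:E * (\1_B x)%:E).
Proof.
move=> mB; rewrite /normal_prob integral_mkcond; apply: eq_integral => x _.
by rewrite patchE indicE; case: ifPn => _; rewrite ?mule1 ?mule0.
Qed.

Lemma measurable_pdf_indic m s B : measurable B ->
  measurable_fun setT (fun x => (normal_pdf m s x)%:E * (\1_B x)%:E).
Proof.
move=> mB; apply: emeasurable_funM; apply/measurable_EFinP.
  exact: measurable_normal_pdf.
exact: measurable_indic.
Qed.

Lemma pdf_indic_ge0 m s B x : 0 <= (normal_pdf m s x)%:E * (\1_B x)%:E.
Proof. by rewrite mule_ge0// lee_fin ?normal_pdf_ge0// indicE. Qed.

Lemma normal_prob_affine a b m s B : a != 0%R -> s != 0%R -> measurable B ->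
  normal_prob m s ((fun x => a * x + b)%R @^-1` B) =
  normal_prob (a * m + b)%R (a * s)%R B.
Proof.
move=> a0 s0 mB; rewrite [RHS]normal_probE//.
rewrite -(@ge0_integral_affine a b)//=; last 2 first.
- exact: measurable_pdf_indic.
- by move=> x; exact: pdf_indic_ge0.
rewrite -ge0_integralZl//=; last 2 first.
- exact: (measurableT_comp (measurable_pdf_indic _ _ mB) (measurable_affine a b)).
- by move=> x _; exact: pdf_indic_ge0.
rewrite normal_probE; last first.
  by rewrite -[X in measurable X]setTI; exact: measurable_affine.
apply: eq_integral => x _; by rewrite [RHS]muleA -[in RHS]EFinM normal_pdf_affine.
Qed.

Lemma normal_prob_shift m B : measurable B ->
  normal_prob 0%R 1%R ((fun x => x + m)%R @^-1` B) = normal_prob m 1%R B.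
Proof.
move=> mB; have := @normal_prob_affine 1 m 0 1 B (oner_neq0 _) (oner_neq0 _) mB.
rewrite mulr0 add0r mulr1 => <-; congr (normal_prob _ _ _).
by apply/seteqP; split => x /=; rewrite mul1r.
Qed.

Lemma normal_probNs m s : normal_prob m (- s)%R = normal_prob m s.
Proof.
apply/funext => B; apply: eq_integral => x _; rewrite /normal_pdf oppr_eq0.
by rewrite /normal_peak /normal_fun sqrrN.
Qed.

(** Completing the square: the joint density of (u, y) is the marginal density of y times the
    conditional density of u given y, with the usual posterior mean and deviation. *)
Lemma normal_pdf_conv r a s u y : a != 0%R -> s != 0%R -> r != 0%R ->
  (r ^+ 2 = s ^+ 2 + a ^+ 2)%R ->
  (normal_pdf u a y * normal_pdf 0 s u =
   normal_pdf 0 r y * normal_pdf (s ^+ 2 * y / r ^+ 2) (s * a / r) u)%R.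
Proof.
move=> a0 s0 r0 rE.
have sar0 : (s * a / r != 0)%R by rewrite !mulf_neq0// invr_neq0.
rewrite !normal_pdfE// [LHS]mulrACA [RHS]mulrACA; congr (_ * _)%R.
  rewrite /normal_peak -!invfM -!sqrtrM; last 2 first.
  - by rewrite mulrn_wge0// mulr_ge0 ?sqr_ge0 ?pi_ge0.
  - by rewrite mulrn_wge0// mulr_ge0 ?sqr_ge0 ?pi_ge0.
  by congr (_^-1)%R; congr Num.sqrt; field.
rewrite /normal_fun -!expRD; congr expR.
have r20 : (s ^+ 2 + a ^+ 2 != 0)%R by rewrite -rE expf_neq0.
rewrite [((s * a / r) ^+ 2)%R]expr_div_n rE; field.
by rewrite r20 s0 a0.
Qed.

Lemma measurable_normal_pdf2 a :
  measurable_fun setT (fun p : R * R => normal_pdf p.1 a p.2).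
Proof.
(* At deviation zero [normal_pdf] is the indicator of [0, 1] whatever the mean, so the translation
   identity used below fails there. *)
have [->|a0] := eqVneq a 0%R.
  rewrite /normal_pdf eqxx.
  by apply: (measurableT_comp (f := \1_`[0%R, 1%R] : R -> R)).
rewrite (_ : (fun _ => _) = (fun p : R * R => normal_pdf 0 a (p.2 - p.1)%R)).
  apply: (measurableT_comp (measurable_normal_pdf 0 a)).
  exact: measurable_funB.
by apply/funext => p; rewrite !normal_pdfE// /normal_fun subr0.
Qed.

Lemma normal_prob_conv r a s B : a != 0%R -> s != 0%R -> r != 0%R ->
  (r ^+ 2 = s ^+ 2 + a ^+ 2)%R -> measurable B ->
  \int[mu]_u ((normal_pdf 0 s u)%:E * normal_prob u a B) = normal_prob 0%R r B.
Proof.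
move=> a0 s0 r0 rE mB.
pose f (p : R * R) := ((normal_pdf p.1 a p.2 * normal_pdf 0 s p.1)%:E *
  (\1_B p.2)%:E)%E.
have f0 p : 0 <= f p.
  by rewrite mule_ge0 ?lee_fin ?mulr_ge0 ?normal_pdf_ge0// indicE.
have mf : measurable_fun setT f.
  apply: emeasurable_funM; apply/measurable_EFinP.
    apply: measurable_funM; first exact: measurable_normal_pdf2.
    exact: measurableT_comp (measurable_normal_pdf 0 s) _.
  by apply: measurableT_comp => //; exact: measurable_indic.
transitivity (\int[mu]_u \int[mu]_y f (u, y)).
  apply: eq_integral => u _; rewrite normal_probE// -ge0_integralZl//=.
  - by apply: eq_integral => y _; rewrite /f/= EFinM muleCA muleA.
  - exact: measurable_pdf_indic.
  - by move=> y _; exact: pdf_indic_ge0.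
  - by rewrite lee_fin normal_pdf_ge0.
rewrite (@fubini_tonelli _ _ _ _ _ mu mu f mf f0) normal_probE//.
apply: eq_integral => y _; rewrite /f/=; under eq_integral do rewrite (@normal_pdf_conv r)//.
transitivity (\int[mu]_u (((normal_pdf 0 r y)%:E * (\1_B y)%:E) *
    (normal_pdf (s ^+ 2 * y / r ^+ 2) (s * a / r) u)%:E)).
  by apply: eq_integral => u _; rewrite EFinM muleAC.
rewrite ge0_integralZl//=; last 3 first.
- by apply/measurable_EFinP; exact: measurable_normal_pdf.
- by move=> u _; rewrite lee_fin normal_pdf_ge0.
- exact: pdf_indic_ge0.
by rewrite integral_normal_pdf mule1.
Qed.

Lemma integral_normal_prob m s (f : R -> \bar R) : s != 0%R ->
  (normal_prob m s).-integrable setT f ->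
  \int[normal_prob m s]_x f x = \int[mu]_x (f x * (normal_pdf m s x)%:E).
Proof.
move=> s0 fi.
rewrite -(Radon_Nikodym_change_of_variables (normal_prob_dominates m s))//=.
have mf := measurable_int _ fi.
apply: ae_eq_integral => //.
- apply: emeasurable_funM => //; apply: (measurable_int mu).
  by apply: Radon_Nikodym_integrable; exact: normal_prob_dominates.
- apply: emeasurable_funM => //=; apply/measurable_EFinP.
  exact: measurable_normal_pdf.
- apply: ae_eqe_mul2l => /=.
  rewrite Radon_NikodymE//=; first exact: normal_prob_dominates.
  move=> ?; case: cid => /= h [h1 h2 h3].
  apply: integral_ae_eq => //=.
  + by apply/measurable_EFinP; exact: measurable_normal_pdf.
  + by move=> E _ mE; rewrite -h3.
Qed.

(** The value at u is the N(0, 1)-measure of the section at u of one measurable subset of the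
    plane. *)
Lemma measurable_normal_prob_mean s B : s != 0%R -> measurable B ->
  measurable_fun setT (fun u : R => normal_prob u s B).
Proof.
move=> s0 mB.
pose A := [set p : R * R | B (s * p.2 + p.1)%R].
have mA : measurable A.
  rewrite -[A]setTI; apply: measurable_funD => //.
  exact: measurable_funM.
have := measurable_fun_xsection (normal_prob 0%R 1%R) mA.
rewrite (_ : _ \o _ = (fun u : R => normal_prob u s B))//.
apply/funext => u /=; have := @normal_prob_affine s u 0 1 B s0 (oner_neq0 _) mB.
rewrite mulr0 add0r mulr1 => <-; congr (normal_prob _ _ _).
by apply/seteqP; split => x; rewrite /xsection /A /= inE.
Qed.

(** This is the law of [X] plus an independent normal variable scaled by [a]. The cases [a = 0] and
    [s = 0] are separated because a degenerate Gaussian has no density. *)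
Lemma gaussian_conv d (Omega : measurableType d) (P : probability Omega R)
    (X : {RV P >-> R}) r a s : (0 <= r)%R -> (r ^+ 2 = s ^+ 2 + a ^+ 2)%R ->
  (forall B, measurable B -> distribution P X B = gaussian 0%R s B) ->
  forall B, measurable B ->
  (P \x normal_prob 0%R 1%R)%E [set p | B (X p.1 + a * p.2)%R] =
  gaussian 0%R r B.
Proof.
move=> r_ge0 rE XE B mB.
transitivity (\int[P]_w normal_prob 0%R 1%R
    ((fun x => a * x + X w)%R @^-1` B)).
  apply: eq_integral => w _ /=; congr (normal_prob _ _ _).
  by apply/seteqP; split => x; rewrite /xsection /= inE/= addrC.
have [a0|a0] := eqVneq a 0%R.
  transitivity (\int[P]_w (\1_(X @^-1` B) w)%:E).
    apply: eq_integral => w _; rewrite indicE; have [wB|wB] := boolP (w \in _).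
      rewrite (_ : _ @^-1` _ = setT) ?probability_setT//.
      by apply/seteqP; split => x //= _; rewrite a0 mul0r add0r; move: wB; rewrite inE.
    rewrite (_ : _ @^-1` _ = set0) ?measure0//.
    apply/seteqP; split => x //=; rewrite a0 mul0r add0r.
    by move: wB; rewrite notin_setE.
  rewrite integral_indic ?setIT//; last first.
    by rewrite -[X in measurable X]setTI; exact: measurable_funP.
  have rs : (r ^+ 2 = s ^+ 2)%R by rewrite rE a0 expr0n addr0.
  rewrite -[LHS]/(distribution P X B) XE//.
  have /orP[/eqP->//|/eqP->] : ((r == s) || (r == - s))%R by rewrite -eqf_sqr rs.
  by rewrite /gaussian oppr_eq0 normal_probNs.
have r0 : r != 0%R.
  by rewrite -sqrf_eq0 rE paddr_eq0 ?sqr_ge0// !sqrf_eq0 (negbTE a0) andbF.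
have E u : normal_prob 0%R 1%R ((fun x => a * x + u)%R @^-1` B) = normal_prob u a B.
  have := @normal_prob_affine a u 0 1 B a0 (oner_neq0 _) mB.
  by rewrite mulr0 add0r mulr1.
under eq_integral do rewrite E.
have mg := measurable_normal_prob_mean a0 mB.
pose mX' := @isMeasurableFun.Build _ _ _ _ (X : Omega -> measurableTypeR R)
  (measurable_funP X).
pose X' : {mfun Omega >-> measurableTypeR R} :=
  HB.pack_for {mfun Omega >-> measurableTypeR R} (X : Omega -> measurableTypeR R) mX'.
rewrite -(@ge0_integral_distribution _ _ _ _ _ _ X' (fun u => normal_prob u a B))//.
rewrite /gaussian (negbTE r0).
have [s0|s0] := eqVneq s 0%R.
  rewrite (@eq_measure_integral _ _ _ _ \d_(0%R : measurableTypeR R)); last first.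
    by move=> A mA _; rewrite -[LHS]/(distribution P X A) XE// /gaussian s0 eqxx.
  rewrite integral_dirac// diracT mul1e.
  have /orP[/eqP->//|/eqP->] : ((r == a) || (r == - a))%R.
    by rewrite -eqf_sqr rE s0 expr0n add0r.
  by rewrite normal_probNs.
transitivity (\int[normal_prob 0%R s]_y normal_prob y a B).
  apply: eq_measure_integral => /=.
  by move=> A mA _; rewrite -[LHS]/(distribution P X A) XE// /gaussian (negbTE s0).
rewrite integral_normal_prob//; last first.
  apply/integrableP; split => //.
  under eq_integral do rewrite gee0_abs//.
  apply: (@le_lt_trans _ _ (\int[normal_prob 0%R s]_x 1)).
    by apply: ge0_le_integral => // x _; exact: probability_le1.
  by rewrite integral_cst// mul1e [X in X < _](probability_setT (normal_prob 0%R s)) ltry.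
under eq_integral do rewrite muleC.
exact: normal_prob_conv.
Qed.

Lemma normal_prob_set1 m s x : normal_prob m s [set x] = 0.
Proof.
have /null_content_dominatesP := normal_prob_dominates m s.
by apply => //; exact: lebesgue_measure_set1.
Qed.

Definition normal_cdf x : R := fine (normal_prob 0%R 1%R `]-oo, x]).

Lemma normal_cdfE x : (normal_cdf x)%:E = normal_prob 0%R 1%R `]-oo, x].
Proof. by rewrite fineK// fin_num_measure. Qed.

Lemma normal_cdf_homo : {homo normal_cdf : x y / (x <= y)%R}.
Proof.
move=> x y xy; rewrite -lee_fin !normal_cdfE; apply: le_measure => //.
- by rewrite inE.
- by rewrite inE.
- by move=> t /=; rewrite !in_itv/= => /le_trans; exact.
Qed.

Lemma measurable_normal_cdf : measurable_fun setT normal_cdf.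
Proof. by apply: nondecreasing_measurable => // x y; exact: normal_cdf_homo. Qed.

(** The density is bounded by its peak. The bound gives continuity at quantiles and later converts
    an error in the distance to the null into an error in power. *)
Lemma normal_cdf_lipschitz x y : (x <= y)%R ->
  (normal_cdf y <= normal_cdf x + normal_peak 1 * (y - x))%R.
Proof.
move=> xy; rewrite -lee_fin EFinD !normal_cdfE.
rewrite (_ : `]-oo, y]%classic = `]-oo, x]%classic `|` `]x, y]%classic); last first.
  by rewrite -itv_bndbnd_setU.
rewrite measureU//; last first.
  apply/seteqP; split => t //=; rewrite !in_itv/= => -[tx /andP[xt _]].
  by move: (lt_le_trans xt tx); rewrite ltxx.
rewrite leeD2l// /normal_prob.
apply: (@le_trans _ _ (\int[mu]_(t in `]x, y]) (normal_peak 1)%:E)).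
  apply: ge0_le_integral => //=.
  - by move=> t _; rewrite lee_fin normal_pdf_ge0.
  - by apply/measurable_EFinP/measurable_funTS; exact: measurable_normal_pdf.
  - by move=> t _; rewrite lee_fin normal_pdf_ub.
rewrite integral_cst// EFinM [X in _ * X <= _]lebesgue_measure_itv/= lte_fin.
rewrite -EFinB; case: ifPn => //; rewrite -leNgt => yx.
by rewrite mule0 lee_fin mulr_ge0 ?normal_peak_ge0 ?subr_ge0.
Qed.

Lemma normal_cdfN x : normal_cdf (- x) = (1 - normal_cdf x)%R.
Proof.
have -> : normal_cdf (- x) = fine (normal_prob 0%R 1%R `[x, +oo[).
  congr fine; have m1 : (-1 != 0 :> R)%R by rewrite oppr_eq0 oner_neq0.
  have := @normal_prob_affine (-1) 0 0 1 `[x, +oo[ m1 (oner_neq0 _).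
  rewrite mulr0 addr0 mulr1 normal_probNs => <- //.
  congr (normal_prob _ _ _); apply/seteqP; split => t /=;
    by rewrite !in_itv/= andbT addr0 mulN1r lerNr.
have -> : normal_cdf x = fine (normal_prob 0%R 1%R `]-oo, x[).
  congr fine; rewrite -(@setUitv1 _ _ -oo%O x true)//=.
  rewrite measureU//=; last first.
    by apply/seteqP; split => t //=; rewrite in_itv/= => -[/[swap] ->]; rewrite ltxx.
  by rewrite normal_prob_set1 adde0.
have /(congr1 fine) : (normal_prob 0%R 1%R `]-oo, x[ +
    normal_prob 0%R 1%R `[x, +oo[ = 1)%E.
  rewrite -measureU//=; last first.
    apply/seteqP; split => t //=; rewrite !in_itv/= andbT => -[tx /(lt_le_trans tx)].
    by rewrite ltxx.
  by rewrite -itv_bndbnd_setU// set_itvE probability_setT.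
by rewrite fineD ?fin_num_measure//= => /(canRL (addKr _)) ->; rewrite addrC.
Qed.

Lemma normal_cdf_z_quantile (q : R) : (0 < q)%R -> (q < 1)%R ->
  normal_cdf (z_quantile q) = q.
Proof.
move=> q0 q1.
set S := [set x : R | q%:E <= normal_prob 0%R 1%R `]-oo, x]].
have SE x : S x = (q <= normal_cdf x)%R.
  by rewrite /S/= -normal_cdfE lee_fin.
pose mid := @isMeasurableFun.Build _ _ _ _ (idfun : measurableTypeR R -> R)
  (@measurable_id _ _ setT).
pose idR : {RV (normal_prob (0%R : R) 1%R) >-> R} :=
  HB.pack_for {mfun measurableTypeR R >-> R} (idfun : measurableTypeR R -> R) mid.
have cdfE : fine \o cdf idR = normal_cdf.
  by apply/funext => x; rewrite /= /cdf /distribution/= /pushforward preimage_id.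
have [x0 Sx0] : S !=set0.
  have F1 : normal_cdf x @[x --> +oo%R] --> (1 : R)%R.
    by rewrite -cdfE; apply: fine_cvg; exact: cvg_cdfy1.
  have /filter_ex[x qx] : \forall x \near +oo%R, (q < normal_cdf x)%R.
    by apply: (cvgr_gt _ F1).
  by exists x; rewrite SE ltW.
have [b Sb] : has_lbound S.
  have F0 : normal_cdf x @[x --> -oo%R] --> (0 : R)%R.
    by rewrite -cdfE; apply: fine_cvg; exact: cvg_cdfNy0.
  have /filter_ex[b bq] : \forall x \near -oo%R, (normal_cdf x < q)%R.
    by apply: (cvgr_lt _ F0).
  exists b => x; rewrite SE => qx.
  by rewrite leNgt; apply/negP => /ltW/normal_cdf_homo/(le_trans qx); rewrite leNgt bq.
have infS : has_inf S by split; [exists x0|exists b].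
have zE : z_quantile q = inf S by [].
have p0 : (0 < normal_peak (1 : R))%R by exact: normal_peak_gt0.
(* A move of [e / normal_peak 1] changes the cdf by at most [e]: that far to the left of the infimum
   lies outside [S], and within that distance to the right there is a point of [S]. *)
apply/eqP; rewrite eq_le; apply/andP; split; apply/ler_addgt0Pr => e e0;
  have d0 : (0 < e / normal_peak 1)%R by exact: divr_gt0.
- have zx : (z_quantile q - e / normal_peak 1 < inf S)%R by rewrite zE ltrBlDr ltrDl.
  have /negP : ~ (q <= normal_cdf (z_quantile q - e / normal_peak 1))%R.
    by rewrite -SE => /(ge_inf infS.2); rewrite leNgt zx.
  rewrite -ltNge => /ltW lq.
  apply: (le_trans (@normal_cdf_lipschitz (z_quantile q - e / normal_peak 1)%R _ _)).
    by rewrite gerBl ltW.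
  by rewrite lerD// opprB addrCA subrr addr0 mulrC divfK// gt_eqF.
- have [x Sx xz] := inf_adherent d0 infS.
  have zx : (z_quantile q <= x)%R by rewrite zE; exact: (ge_inf infS.2).
  move: Sx; rewrite SE => /le_trans; apply.
  apply: (le_trans (normal_cdf_lipschitz zx)); rewrite lerD2l.
  apply: (@le_trans _ _ (normal_peak 1 * (e / normal_peak 1))%R); last first.
    by rewrite mulrC divfK// gt_eqF.
  by rewrite ler_pM2l// lerBlDl ltW.
Qed.

Lemma normal_pdf01_le x y : (`|x| <= `|y|)%R ->
  (normal_pdf 0 1 y <= normal_pdf 0 1 x)%R.
Proof.
move=> xy; rewrite !normal_pdfE ?oner_neq0// ler_pM2l ?normal_peak_gt0//.
rewrite /normal_fun ler_expR !subr0 !mulNr lerN2 ler_pM2r; last first.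
  by rewrite invr_gt0 expr1n.
by rewrite -(real_normK (num_real x)) -(real_normK (num_real y)) lerXn2r ?nnegrE.
Qed.

(** Anderson's inequality on the line. [I] and [J] have equal length, and the density is at least
    [k], its value at [c], on [I] and at most [k] off [I]; adding [k] times the lengths makes the
    comparison pointwise. *)
Lemma normal_prob_itvcc_shift (c u : R) : (0 <= c)%R ->
  normal_prob 0%R 1%R [set x : R | `|x + u| <= c]%R <=
  normal_prob 0%R 1%R [set x : R | `|x| <= c]%R.
Proof.
move=> c0; pose I : set R := `[(- c)%R, c]%classic.
pose J : set R := `[(- c - u)%R, (c - u)%R]%classic.
have -> : [set x : R | `|x + u| <= c]%R = J.
  by apply/seteqP; split => x /=; rewrite /J/= in_itv/= ler_norml lerBlDr lerBrDr.
have -> : [set x : R | `|x| <= c]%R = I.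
  by apply/seteqP; split => x /=; rewrite /I/= in_itv/= ler_norml.
have mI : measurable I by exact: measurable_itv.
have mJ : measurable J by exact: measurable_itv.
set k := normal_pdf 0 1 c; have k0 : (0 <= k)%R by exact: normal_pdf_ge0.
have lI : mu I = (c + c)%:E.
  rewrite lebesgue_measure_itv/= lte_fin -EFinB opprK.
  by case: ltP => // h; congr EFin; lra.
have lJ : mu J = (c + c)%:E.
  rewrite lebesgue_measure_itv/= lte_fin -EFinB ltrD2r.
  by case: ltP => // h; congr EFin; lra.
have mk B : measurable B -> measurable_fun setT (fun x : R => k%:E * (\1_B x)%:E).
  by move=> mB; apply: emeasurable_funM => //; apply/measurable_EFinP/measurable_indic.
have k_ge0 B x : 0 <= k%:E * (\1_B x)%:E by rewrite mule_ge0// lee_fin indicE.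
have kE B : measurable B -> \int[mu]_x (k%:E * (\1_B x)%:E) = k%:E * mu B.
  move=> mB; rewrite ge0_integralZl//; last first.
    by apply/measurable_EFinP/measurable_indic.
  by rewrite integral_indic// setIT.
pose h B B' (x : R) : \bar R :=
  (normal_pdf 0 1 x)%:E * (\1_B x)%:E + k%:E * (\1_B' x)%:E.
have hE B B' : measurable B -> measurable B' ->
    normal_prob 0%R 1%R B + k%:E * mu B' = \int[mu]_x h B B' x.
  move=> mB mB'; rewrite normal_probE// -kE// -ge0_integralD//.
  - by move=> x _; exact: pdf_indic_ge0.
  - exact: measurable_pdf_indic.
  - exact: mk.
have h0 B B' x : 0 <= h B B' x by rewrite adde_ge0 ?pdf_indic_ge0.
have mh B B' : measurable B -> measurable B' -> measurable_fun setT (h B B').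
  by move=> mB mB'; apply: emeasurable_funD; [exact: measurable_pdf_indic|exact: mk].
have fin : k%:E * (c + c)%:E \is a fin_num by [].
rewrite -(leeD2rE _ _ fin) -[X in X <= _]/(normal_prob 0%R 1%R J + k%:E * (c + c)%:E).
rewrite -[in X in X <= _]lI -[in X in _ <= X]lJ !hE//.
apply: ge0_le_integral => //; [exact: mh|exact: mh|].
move=> x _; rewrite /h -!EFinM -!EFinD lee_fin !indicE.
have [xI|xI] := boolP (x \in I); have [xJ|xJ] := boolP (x \in J);
  rewrite ?mulr1 ?mulr0 ?addr0 ?add0r//.
- move: xI; rewrite inE /I/= in_itv/= -ler_norml => xc.
  by apply: normal_pdf01_le; rewrite (ger0_norm c0).
- move: xI; rewrite notin_setE /I/= in_itv/= -ler_norml => /negP; rewrite -ltNge.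
  by move=> /ltW cx; apply: normal_pdf01_le; rewrite (ger0_norm c0).
Qed.

(** The interval carries mass alpha, not 1 - alpha, because it serves as a rejection region. With
    [q] the mass of each tail, [c] is minus the [q]-quantile. *)
Lemma normal_two_sided_critical (alpha : R) : (0 < alpha)%R -> (alpha < 1)%R ->
  exists2 c : R, (0 < c)%R &
    normal_prob 0%R 1%R [set x : R | `|x| <= c]%R = alpha%:E.
Proof.
move=> a0 a1; pose q := ((1 - alpha) / 2)%R.
have q0 : (0 < q)%R by rewrite /q; lra.
have q1 : (q < 1)%R by rewrite /q; lra.
have half : normal_cdf 0 = (1 / 2)%R.
  by have := normal_cdfN 0; rewrite oppr0; lra.
pose b : R := z_quantile q; have bq : normal_cdf b = q by exact: normal_cdf_z_quantile.
have b0 : (b < 0)%R.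
  rewrite ltNge; apply/negP => /normal_cdf_homo; rewrite half bq /q; lra.
exists (- b)%R; first by rewrite oppr_gt0.
have mI : measurable (`[b, (- b)%R]%classic : set R) by [].
have -> : [set x : R | `|x| <= - b]%R = `[b, (- b)%R]%classic.
  by apply/seteqP; split => x /=; rewrite in_itv/= ler_norml opprK.
have E : (normal_cdf (- b))%:E = (normal_cdf b)%:E + normal_prob 0%R 1%R `]b, (- b)%R].
  rewrite !normal_cdfE -measureU//; last first.
    apply/seteqP; split => t //=; rewrite !in_itv/= => -[tx /andP[xt _]].
    by move: (lt_le_trans xt tx); rewrite ltxx.
  by rewrite -itv_bndbnd_setU// bnd_simp; lra.
have -> : normal_prob 0%R 1%R `[b, (- b)%R] = normal_prob 0%R 1%R `]b, (- b)%R].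
  rewrite -(@setU1itv _ _ _ b false) ?bnd_simp; last by lra.
  rewrite measureU//=; last first.
    by apply/seteqP; split => t //=; rewrite in_itv/= => -[->]; rewrite ltxx.
  by rewrite normal_prob_set1 add0e.
move: E; rewrite normal_cdfN bq.
have -> : normal_prob 0%R 1%R `]b, (- b)%R] =
    (fine (normal_prob 0%R 1%R `]b, (- b)%R]))%:E by rewrite fineK// fin_num_measure.
by rewrite -EFinD => -[] h; congr EFin; move: h; rewrite /q; lra.
Qed.

Lemma cv_ge0 (alpha t : R) : (alpha < 1)%R -> (0 <= cv alpha t)%R.
Proof.
move=> a1; rewrite /cv /quantile; set S := [set x : R | _].
have SP x : S x -> (0 <= x)%R.
  rewrite /S/= /pushforward => qx; rewrite leNgt; apply/negP => x0; move: qx.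
  rewrite (_ : _ @^-1` _ = set0) ?measure0 ?lee_fin; first by lra.
  apply/seteqP; split => y //=; rewrite in_itv/= => yx.
  by have := le_lt_trans yx x0; rewrite ltNge normr_ge0.
(* The infimum of the empty set is 0 by convention. *)
have [->|/set0P[x Sx]] := eqVneq S set0; first by rewrite inf0.
by apply: lb_le_inf => //; exists x.
Qed.

End gaussian_measures.

(** * Laws of linear processes *)

Section sign_iteration.
Local Open Scope ring_scope.
Context {R : realType}.

(* The iterates of this polynomial converge to the sign on [-1, 1]. *)
Definition sign_step (u : R) : R := (3 * u - u ^+ 3) / 2.

Lemma iter_sign_stepN (n : nat) (u : R) :
  iter n sign_step (- u) = - iter n sign_step u.
Proof. by elim: n => // n IH; rewrite !iterS IH /sign_step; field. Qed.

Lemma iter_sign_step0 (n : nat) : iter n sign_step 0 = 0.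
Proof. by elim: n => // n IH; rewrite iterS IH /sign_step; field. Qed.

(** One step multiplies the gap 1 - v by 1 - (v + v^2) / 2, which is at most 1 - u / 2 because the
    iterates stay above [u]. *)
Lemma iter_sign_step_bounds (n : nat) (u : R) : 0 < u -> u <= 1 ->
  [/\ u <= iter n sign_step u, iter n sign_step u <= 1 &
      1 - iter n sign_step u <= (1 - u / 2) ^+ n].
Proof.
move=> u0 u1; elim: n => [|n [IH1 IH2 IH3]].
  by rewrite /= expr0; split => //; lra.
rewrite iterS; set v := iter n _ u in IH1 IH2 IH3 *.
have v0 : 0 < v by exact: lt_le_trans u0 IH1.
have E : 1 - sign_step v = (1 - v) * ((1 - v) * (2 + v) / 2).
  by rewrite /sign_step; field.
have w0 : 0 <= 1 - v by lra.
have a0 : 0 <= (1 - v) * (2 + v) / 2 by rewrite divr_ge0// mulr_ge0//; lra.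
have vv : v ^+ 2 <= 1 by rewrite expr_le1// ltW.
split.
- apply: (le_trans IH1); rewrite /sign_step -subr_ge0.
  have -> : (3 * v - v ^+ 3) / 2 - v = v * (1 - v ^+ 2) / 2 by field.
  by rewrite divr_ge0// mulr_ge0 ?subr_ge0// ltW.
- by rewrite -subr_ge0 E mulr_ge0.
- rewrite E exprSr ler_pM//.
  have -> : (1 - v) * (2 + v) / 2 = 1 - (v + v ^+ 2) / 2 by field.
  by have := sqr_ge0 v; lra.
Qed.

Lemma norm_iter_sign_step (n : nat) (u : R) : `|u| <= 1 ->
  `|iter n sign_step u| <= 1.
Proof.
have H (v : R) : 0 < v -> v <= 1 -> `|iter n sign_step v| <= 1.
  move=> v0 v1; have [h1 h2 _] := iter_sign_step_bounds n v0 v1.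
  by rewrite ger0_norm// (le_trans (ltW v0)).
move=> u1; have [u0|u0|->] := ltrgt0P u; last by rewrite iter_sign_step0 normr0.
- by apply: H => //; apply: le_trans u1; exact: ler_norm.
- rewrite -[u]opprK iter_sign_stepN normrN; apply: H; first by rewrite oppr_gt0.
  by apply: le_trans u1; rewrite -normrN; exact: ler_norm.
Qed.

Lemma cvg_iter_sign_step (u : R) : `|u| <= 1 ->
  iter n sign_step u @[n --> \oo] --> Num.sg u.
Proof.
have H (v : R) : 0 < v -> v <= 1 -> iter n sign_step v @[n --> \oo] --> (1 : R).
  move=> v0 v1.
  have z1 : `|1 - v / 2| < 1 by rewrite ltr_norml; apply/andP; split; lra.
  apply: (@squeeze_cvgr _ _ _ _ (fun n => 1 - (1 - v / 2) ^+ n) (cst 1)).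
  - apply: nearW => n; have [_ h2 h3] := iter_sign_step_bounds n v0 v1.
    by rewrite h2 andbT; lra.
  - rewrite -[X in _ --> X]subr0; apply: cvgB; first exact: cvg_cst.
    have := cvg_geometric 1 z1; rewrite /geometric.
    by under eq_fun do rewrite mul1r.
  - exact: cvg_cst.
move=> u1; have [u0|u0|->] := ltrgt0P u.
- by rewrite gtr0_sg//; apply: H => //; apply: le_trans u1; exact: ler_norm.
- rewrite ltr0_sg// (_ : (fun n => _) = (fun n => - iter n sign_step (- u))); last first.
    by apply/funext => n; rewrite iter_sign_stepN opprK.
  apply: cvgN; apply: H; first by rewrite oppr_gt0.
  by apply: le_trans u1; rewrite -normrN; exact: ler_norm.
- rewrite sgr0 (_ : (fun n => _) = cst 0); first exact: cvg_cst.
  by apply/funext => n; exact: iter_sign_step0.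
Qed.

(** Once n exceeds |x|, the rescaled argument has absolute value below 2, where sine has the sign of
    its argument; the sequence is eventually constant. *)
Lemma cvg_sg_sin (x : R) :
  Num.sg (sin (n.+1%:R^-1 * x)) @[n --> \oo] --> Num.sg x.
Proof.
have H (y : R) (n : nat) : 0 < y -> y < n%:R -> 0 < sin (n.+1%:R^-1 * y).
  move=> y0 yn; apply: sin2_gt0; rewrite mulr_gt0 ?invr_gt0 ?ltr0n//=.
  rewrite mulrC ltr_pdivrMr ?ltr0n//; apply: (lt_trans yn).
  by rewrite -natrM ltr_nat (leq_trans (ltnSn n))// leq_pmull.
apply: cvg_near_cst; near=> n.
have xn : `|x| < n%:R by near: n; exact: nbhs_infty_gtr.
have [x0|x0|->] := ltrgt0P x; last by rewrite mulr0 sin0.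
- by rewrite !gtr0_sg// H// (le_lt_trans (ler_norm _) xn).
- rewrite [RHS]ltr0_sg// -[x]opprK mulrN sinN sgrN gtr0_sg// H ?oppr_gt0//.
  by apply: le_lt_trans xn; rewrite -normrN; exact: ler_norm.
Unshelve. all: by end_near. Qed.

End sign_iteration.

(** * From cosines of evaluations to indicators of measurable sets *)

Section trigonometric_multipliers.
Local Open Scope ring_scope.
Context {R : realType} {H : lmodType R}.
Local Notation S := (sample_space R H).

Lemma measurable_evaluation (h : H) :
  measurable_fun setT (fun y : S => (y h : R)).
Proof.
move=> _ B mB; rewrite setTI; apply: sub_sigma_algebra.
by exists h, B.
Qed.

Definition bounded_measurable (f : S -> R) :=
  measurable_fun setT f /\ exists M : R, forall y, `|f y| <= M.

Lemma bounded_measurable_cst (r : R) : bounded_measurable (cst r).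
Proof. by split => //; exists `|r|. Qed.

Lemma bounded_measurable_lin (a : R) (f g : S -> R) :
  bounded_measurable f -> bounded_measurable g ->
  bounded_measurable (fun y => a * f y + g y).
Proof.
move=> [mf [M fM]] [mg [N gN]]; split.
  by apply: measurable_funD => //; exact: measurable_funM.
exists (`|a| * M + N) => y; rewrite (le_trans (ler_normD _ _))// lerD// normrM.
by rewrite ler_wpM2l.
Qed.

Lemma bounded_measurableM (f g : S -> R) :
  bounded_measurable f -> bounded_measurable g ->
  bounded_measurable (fun y => f y * g y).
Proof.
move=> [mf [M fM]] [mg [N gN]]; split; first exact: measurable_funM.
by exists (M * N) => y; rewrite normrM ler_pM.
Qed.

Lemma norm_cos_le1 (x : R) : `|cos x| <= 1.
Proof. by rewrite ler_norml cos_geN1 cos_le1. Qed.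

Lemma norm_sin_le1 (x : R) : `|sin x| <= 1.
Proof. by rewrite ler_norml sin_geN1 sin_le1. Qed.

Lemma bounded_measurable_cos (h k : H) (t c : R) :
  bounded_measurable (fun y => cos (t * y k + y h + c)).
Proof.
split; last by exists 1 => y; exact: norm_cos_le1.
apply: measurableT_comp; first by apply: continuous_measurable_fun; exact: continuous_cos.
apply: measurable_funD => //; apply: measurable_funD; last exact: measurable_evaluation.
by apply: measurable_funM => //; exact: measurable_evaluation.
Qed.

Lemma bounded_measurable_cos1 (h : H) (c : R) :
  bounded_measurable (fun y => cos (y h + c)).
Proof.
have := bounded_measurable_cos h h 0 c.
by rewrite (_ : (fun _ => _) = (fun y => cos (y h + c)))//; apply/funext => y;
  rewrite mul0r add0r.
Qed.

(** [agree f] stands for equality of the expectations of [f] under two laws. Sample points are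
    arbitrary functions, linear only almost surely; [agree_add] and [agree_zero] let linearity be
    used under the expectation, next to a bounded factor. *)
Variable agree : (S -> R) -> Prop.
Hypothesis agree_lin : forall a f g, bounded_measurable f -> bounded_measurable g ->
  agree f -> agree g -> agree (fun y => a * f y + g y).
Hypothesis agree_lim : forall (u : nat -> S -> R) (f : S -> R) (M : R),
  (forall n, measurable_fun setT (u n)) -> (forall n y, `|u n y| <= M) ->
  (forall n, agree (u n)) -> (forall y, u n y @[n --> \oo] --> f y) -> agree f.
Hypothesis agree_add : forall W h k t c, bounded_measurable W ->
  agree (fun y => W y * cos (y (t *: k + h) + c)) ->
  agree (fun y => W y * cos (t * y k + y h + c)).
Hypothesis agree_zero : forall W, bounded_measurable W ->
  agree (fun y => W y * cos (y 0 + 0)) -> agree W.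
Hypothesis agree_cos : forall h c, agree (fun y => cos (y h + c)).

Let good (W : S -> R) := bounded_measurable W /\
  forall h c, agree (fun y => W y * cos (y h + c)).

(** Products of [good] functions are not visibly [good], whereas [multiplier] is closed under
    products by composition; this is what yields an algebra. *)
Let multiplier (U : S -> R) := bounded_measurable U /\
  forall W, good W -> good (fun y => W y * U y).

Let good1 : good (cst 1).
Proof.
split; first exact: bounded_measurable_cst.
move=> h c; have := agree_cos h c; congr agree; apply/funext => y.
by rewrite mul1r.
Qed.

Let good_lin a U V : good U -> good V -> good (fun y => a * U y + V y).
Proof.
move=> [bU gU] [bV gV]; split; first exact: bounded_measurable_lin.
move=> h c; have bc := bounded_measurable_cos1 h c.
have := agree_lin a (bounded_measurableM bU bc) (bounded_measurableM bV bc)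
  (gU h c) (gV h c).
by congr agree; apply/funext => y; rewrite mulrDl mulrA.
Qed.

Let good_lim (u : nat -> S -> R) (f : S -> R) (M : R) :
  (forall n, good (u n)) -> (forall n y, `|u n y| <= M) ->
  (forall y, u n y @[n --> \oo] --> f y) -> good f.
Proof.
move=> gu uM uf; split.
  split; first by apply: (@measurable_fun_cvg _ _ _ _ u) => // n; exact: (gu n).1.1.
  exists M => y; apply: (ler_cvg_to (cvg_norm (uf y)) (cvg_cst M)).
  by apply: nearW => n; exact: uM.
move=> h c; apply: (@agree_lim (fun n y => u n y * cos (y h + c)) _ M).
- by move=> n; exact: (bounded_measurableM (gu n).1 (bounded_measurable_cos1 h c)).1.
- move=> n y; rewrite normrM -[leRHS]mulr1 ler_pM// ?norm_cos_le1//.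
- by move=> n; exact: (gu n).2.
- by move=> y; apply: cvgMl; exact: uf.
Qed.

Let multiplier_cst r : multiplier (cst r).
Proof.
split; first exact: bounded_measurable_cst.
(* Closure is stated for a U + V only, so r W is written as (r - 1) W + W. *)
move=> W gW; have := good_lin (r - 1) gW gW; congr good; apply/funext => y /=.
ring.
Qed.

Let multiplier_lin a U V :
  multiplier U -> multiplier V -> multiplier (fun y => a * U y + V y).
Proof.
move=> [bU mU] [bV mV]; split; first exact: bounded_measurable_lin.
move=> W gW; have := good_lin a (mU _ gW) (mV _ gW); congr good.
by apply/funext => y; rewrite mulrDr mulrCA.
Qed.

Let multiplierM U V : multiplier U -> multiplier V -> multiplier (fun y => U y * V y).
Proof.
move=> [bU mU] [bV mV]; split; first exact: bounded_measurableM.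
move=> W gW; have := mV _ (mU _ gW); congr good.
by apply/funext => y; rewrite mulrA.
Qed.

Let multiplier_lim (u : nat -> S -> R) (f : S -> R) (M : R) :
  (forall n, multiplier (u n)) ->
  (forall n y, `|u n y| <= M) -> (forall y, u n y @[n --> \oo] --> f y) ->
  multiplier f.
Proof.
move=> mu uM uf; split.
  split; first by apply: (@measurable_fun_cvg _ _ _ _ u) => // n; exact: (mu n).1.1.
  exists M => y; apply: (ler_cvg_to (cvg_norm (uf y)) (cvg_cst M)).
  by apply: nearW => n; exact: uM.
move=> W gW; have [[mW [N WN]] _] := gW.
apply: (@good_lim (fun n y => W y * u n y) _ (N * M)).
- by move=> n; exact: (mu n).2.
- by move=> n y; rewrite normrM ler_pM.
- by move=> y; apply: cvgMr; exact: uf.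
Qed.

Let measurable_affine_evaluation k (t b : R) :
  measurable_fun setT (fun y : S => t * y k + b).
Proof.
by apply: measurable_funD => //; apply: measurable_funM => //; exact: measurable_evaluation.
Qed.

(** The product of two cosines is half a sum of cosines, and [agree_add] absorbs the term [t * y k]
    into the evaluation point. *)
Let multiplier_cos k (t b : R) : multiplier (fun y => cos (t * y k + b)).
Proof.
have bc : bounded_measurable (fun y => cos (t * y k + b)).
  split; last by exists 1 => y; exact: norm_cos_le1.
  apply: measurableT_comp => //.
  by apply: continuous_measurable_fun; exact: continuous_cos.
split => // W [bW gW]; split; first exact: bounded_measurableM.
move=> h c.
have bWc s d : bounded_measurable (fun y => W y * cos (s * y k + y h + d)).
  by apply: bounded_measurableM => //; exact: bounded_measurable_cos.
have aWc s d : agree (fun y => W y * cos (s * y k + y h + d)) by apply: agree_add.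
have b2 := bounded_measurable_lin 1 (bWc t (b + c)) (bWc (- t) (c - b)).
have a2 := agree_lin 1 (bWc t (b + c)) (bWc (- t) (c - b)) (aWc _ _) (aWc _ _).
have := agree_lin (- 2^-1) b2 b2 a2 a2.
congr agree; apply/funext => y.
rewrite (_ : t * y k + y h + (b + c) = (t * y k + b) + (y h + c)); last by ring.
rewrite (_ : - t * y k + y h + (c - b) = (y h + c) - (t * y k + b)); last by ring.
set A := t * y k + b; set B := y h + c.
by rewrite (cosD A B) (cosB B A); field.
Qed.

Let multiplier_sin k (t b : R) : multiplier (fun y => sin (t * y k + b)).
Proof.
have := multiplier_lin (-1) (multiplier_cos k t (b + pi / 2)) (multiplier_cst 0).
by congr multiplier; apply/funext => y; rewrite addrA cosDpihalf /cst; ring.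
Qed.

Let multiplier_sg U : multiplier U -> (forall y, `|U y| <= 1) ->
  multiplier (fun y => Num.sg (U y)).
Proof.
move=> mU U1; apply: (@multiplier_lim (fun n y => iter n sign_step (U y)) _ 1).
- elim=> [//|n mV]; have := multiplier_lin (3 / 2) mV (multiplier_lin (- 2^-1)
    (multiplierM (multiplierM mV mV) mV) (multiplier_cst 0)).
  by congr multiplier; apply/funext => y; rewrite iterS /sign_step /cst; field.
- by move=> n y; exact: norm_iter_sign_step.
- by move=> y; exact: cvg_iter_sign_step.
Qed.

Let multiplier_sg_evaluation k (b : R) : multiplier (fun y => Num.sg (y k - b)).
Proof.
apply: (@multiplier_lim (fun n y => Num.sg (sin (n.+1%:R^-1 * (y k - b)))) _ 1).
- move=> n; apply: multiplier_sg; last by move=> y; exact: norm_sin_le1.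
  have := multiplier_sin k n.+1%:R^-1 (- (n.+1%:R^-1 * b)).
  by congr multiplier; apply/funext => y; rewrite -mulrBr.
- by move=> n y; rewrite normr_sg; case: (_ == _).
- by move=> y; exact: cvg_sg_sin.
Qed.

(** With s the sign of [y k - b], the indicator is 1 - (s^2 + s) / 2; the value s = 0 is sent to
    1. *)
Let multiplier_le k (b : R) : multiplier (\1_[set y : S | y k <= b]).
Proof.
have m := multiplier_sg_evaluation k b.
have := multiplier_lin (- 2^-1) (multiplier_lin 1 (multiplierM m m) m) (multiplier_cst 1).
congr multiplier; apply/funext => y; rewrite indicE /cst.
have [yb|yb|yb] := ltrgtP (y k) b.
- by rewrite mem_set/= ?ltW// ltr0_sg ?subr_lt0//; ring.
- by rewrite memNset/= ?gtr0_sg ?subr_gt0 ?leNgt ?yb//; field.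
- by rewrite mem_set/= ?yb// subrr sgr0; ring.
Qed.

(** Products are available, so a countable union needs no disjointness: its indicator is the bounded
    limit of 1 minus finite products of complementary indicators. *)
Let sigma_algebra_multiplier : sigma_algebra setT [set A : set S | multiplier \1_A].
Proof.
split => /=.
- by rewrite indic0; exact: multiplier_cst.
- move=> A mA; have := multiplier_lin (-1) mA (multiplier_cst 1).
  congr multiplier; apply/funext => y; rewrite !indicE in_setD in_setT /cst/=.
  by case: (_ \in _) => /=; ring.
- move=> A mA; apply: (@multiplier_lim
    (fun n y => 1 - \prod_(k < n) (1 - \1_(A k) y)) _ 1).
  + move=> n; have : multiplier (fun y => \prod_(k < n) (1 - \1_(A k) y)).
      elim: n => [|n IH].
        rewrite (_ : (fun _ => _) = cst 1); first exact: multiplier_cst.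
        by apply/funext => y; rewrite big_ord0.
      have := multiplierM IH (multiplier_lin (-1) (mA n) (multiplier_cst 1)).
      by congr multiplier; apply/funext => y; rewrite big_ord_recr/= /cst; ring.
    move=> m; have := multiplier_lin (-1) m (multiplier_cst 1).
    by congr multiplier; apply/funext => y; rewrite /cst; ring.
  + move=> n y.
    have : 0 <= (\prod_(k < n) (1 - \1_(A k) y) : R) <= 1.
      apply/andP; split.
        by apply: prodr_ge0 => k _; rewrite indicE; case: (_ \in _) => /=; lra.
      apply: prodr_ile1 => k _; rewrite indicE; case: (_ \in _) => /=;
        by apply/andP; split; lra.
    by move=> /andP[h1 h2]; rewrite ger0_norm; lra.
  + move=> y; apply: cvg_near_cst; rewrite indicE.
    have [|yA] := boolP (y \in _).
      rewrite inE => -[k _ Aky]; exists k.+1 => // n /= kn.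
      rewrite (bigD1 (Ordinal kn))//= indicE mem_set//= subrr mul0r.
      ring.
    apply: nearW => n; rewrite big1 ?subrr// => k _.
    rewrite indicE memNset ?subr0// => Aky; move: yA; rewrite notin_setE; apply.
    by exists k.
Qed.

Lemma agree_indic (A : set S) : measurable A -> agree \1_A.
Proof.
move=> mA; suff [_ /(_ _ good1)[b1 g1]] : multiplier \1_A.
  (* Applied to the constant 1, the multiplier gives agreement next to cos (y 0), a factor that
     [agree_zero] removes. *)
  have := agree_zero b1 (g1 0 0); congr agree.
  by apply/funext => y; rewrite mul1r.
move: A mA; apply: smallest_sub; first exact: sigma_algebra_multiplier.
move=> _ [h [B [mB ->]]].
pose ev := (fun y : S => y h : R).
suff : measurable `<=` image_set_system setT ev [set A : set S | multiplier \1_A].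
  by move=> /(_ _ mB); rewrite /image_set_system/= setTI.
apply: smallest_sub; first exact: sigma_algebra_image sigma_algebra_multiplier.
move=> _ [[a b] _ <-]; rewrite /image_set_system/= setTI.
have := multiplierM (multiplier_le h b)
  (multiplier_lin (-1) (multiplier_le h a) (multiplier_cst 1)).
congr multiplier; apply/funext => y; rewrite !indicE /ev /cst.
have -> : (y \in (fun y : S => y h) @^-1` `]a, b]) = (a < y h <= b).
  by apply/idP/idP; rewrite inE/= in_itv.
have E (c : R) : (y \in [set y0 : S | y0 h <= c]) = (y h <= c).
  by apply/idP/idP; rewrite inE.
by rewrite !E ltNge; case: (y h <= a); case: (y h <= b) => /=; ring.
Qed.

End trigonometric_multipliers.

(** * Uniqueness of the law given the one-dimensional marginals *)

Section cramer_wold.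
Local Open Scope ring_scope.
Context {R : realType} {H : lmodType R}.
Local Notation S := (sample_space R H).

Lemma measurable_fun_sample_space d (T : measurableType d) (Y : T -> S) :
  (forall h, measurable_fun setT (fun w => Y w h)) -> measurable_fun setT Y.
Proof.
move=> mY _ A mA.
suff : measurable `<=` image_set_system setT Y measurable by apply.
apply: smallest_sub; first exact: sigma_algebra_image (sigma_algebra_measurable _).
by move=> _ [h [B [mB ->]]]; exact: mY.
Qed.

Section one_space.
Context d (T : measurableType d) (P : probability T R) (Y : T -> S).
Hypothesis mY : measurable_fun setT Y.

Lemma integrable_bounded_comp (f : S -> R) :
  bounded_measurable f -> P.-integrable setT (EFin \o (f \o Y)).
Proof.
move=> [mf [M fM]]; apply: measurable_bounded_integrable => //.
- by rewrite ltey_eq fin_num_measure.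
- exact: measurableT_comp.
- exists M; split; first exact: num_real.
  by move=> x Mx w _ /=; rewrite (le_trans (fM _))// ltW.
Qed.

Lemma Rintegral_lin (a : R) (f g : S -> R) :
  bounded_measurable f -> bounded_measurable g ->
  \int[P]_w (a * f (Y w) + g (Y w)) =
  a * \int[P]_w f (Y w) + \int[P]_w g (Y w).
Proof.
move=> bf bg; have fi := integrable_bounded_comp bf.
rewrite RintegralD//.
- by rewrite RintegralZl.
- rewrite (_ : _ \o _ = fun w => a%:E * (EFin \o (f \o Y)) w)%E//.
  exact: integrableZl.
- exact: integrable_bounded_comp.
Qed.

Lemma cvg_Rintegral_bounded (u : nat -> S -> R) (f : S -> R) (M : R) :
  (forall n, measurable_fun setT (u n)) -> (forall n y, `|u n y| <= M) ->
  (forall y, u n y @[n --> \oo] --> f y) ->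
  \int[P]_w u n (Y w) @[n --> \oo] --> \int[P]_w f (Y w).
Proof.
move=> mu uM uf.
have bf : bounded_measurable f.
  split; first exact: (@measurable_fun_cvg _ _ _ _ u).
  exists M => y; apply: (ler_cvg_to (cvg_norm (uf y)) (cvg_cst M)).
  by apply: nearW => n; exact: uM.
apply: fine_cvg; rewrite fineK; last first.
  by apply: integrable_fin_num => //; exact: integrable_bounded_comp.
apply: (@dominated_cvg _ _ _ _ _ _ (fun n => EFin \o (u n \o Y)) _ (cst M%:E)) => //.
- by move=> n; apply/measurable_EFinP; exact: measurableT_comp.
- by move=> w _; apply: cvg_EFin; [exact: nearW|exact: uf].
- exact: finite_measure_integrable_cst.
- by move=> n w _; rewrite /= lee_fin.
Qed.

Lemma ae_eq_Rintegral (f g : S -> R) :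
  bounded_measurable f -> bounded_measurable g ->
  {ae P, forall w, f (Y w) = g (Y w)} ->
  \int[P]_w f (Y w) = \int[P]_w g (Y w).
Proof.
move=> bf bg fg; congr fine; apply: ae_eq_integral => //.
- by apply/measurable_EFinP; apply: measurableT_comp mY; exact: bf.1.
- by apply/measurable_EFinP; apply: measurableT_comp mY; exact: bg.1.
- by apply: filterS fg => w + _ => ->.
Qed.

End one_space.

(** A Cramér-Wold theorem for an arbitrary index space. Each instance of linearity is used inside a
    single integral, so the null sets may depend on the vectors and the scalar. *)
Lemma linear_process_law_unique d1 (T1 : measurableType d1) (P1 : probability T1 R)
    d2 (T2 : measurableType d2) (P2 : probability T2 R) (Y1 : T1 -> S) (Y2 : T2 -> S) :
  measurable_fun setT Y1 -> measurable_fun setT Y2 ->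
  (forall a h k, {ae P1, forall w, Y1 w (a *: h + k) = a * Y1 w h + Y1 w k}) ->
  (forall a h k, {ae P2, forall w, Y2 w (a *: h + k) = a * Y2 w h + Y2 w k}) ->
  (forall h B, measurable B -> P1 [set w | B (Y1 w h)] = P2 [set w | B (Y2 w h)]) ->
  forall A, measurable A -> P1 (Y1 @^-1` A) = P2 (Y2 @^-1` A).
Proof.
move=> mY1 mY2 lin1 lin2 law A mA.
have preI d (T : measurableType d) (P : probability T R) (Y : T -> S) :
    measurable_fun setT Y -> P (Y @^-1` A) = (\int[P]_w \1_A (Y w))%:E.
  move=> mY; rewrite -[LHS]fineK; last first.
    by apply: fin_num_measure; rewrite -[X in measurable X]setTI; exact: mY.
  congr (fine _)%:E.
  rewrite -(setIT (_ @^-1` _)) -integral_indic//; last first.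
    by rewrite -[X in measurable X]setTI; exact: mY.
rewrite !preI//; congr EFin.
apply: (@agree_indic R H
  (fun f => \int[P1]_w f (Y1 w) = \int[P2]_w f (Y2 w))) => //.
- move=> a f g bf bg fE gE; rewrite !Rintegral_lin//; congr (_ * _ + _) => //.
- move=> u f M mu uM uE uf.
  have h1 := @cvg_Rintegral_bounded _ _ P1 _ mY1 u f M mu uM uf.
  have h2 := @cvg_Rintegral_bounded _ _ P2 _ mY2 u f M mu uM uf.
  move: h1; have -> : (fun n => \int[P1]_w u n (Y1 w)) =
      (fun n => \int[P2]_w u n (Y2 w)) by exact/funext.
  by move=> h1; exact: (cvg_unique _ h1 h2).
- move=> W h k t c bW E.
  have b1 := bounded_measurableM bW (bounded_measurable_cos h k t c).
  have b2 := bounded_measurableM bW (bounded_measurable_cos1 (t *: k + h) c).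
  rewrite (ae_eq_Rintegral mY1 b1 b2); last first.
    by have := lin1 t k h; apply: filterS => w ->.
  rewrite (ae_eq_Rintegral mY2 b1 b2)//.
  by have := lin2 t k h; apply: filterS => w ->.
- move=> W bW E; have b2 := bounded_measurableM bW (bounded_measurable_cos1 0 0).
  have Z d (T : measurableType d) (P : probability T R) (Y : T -> S) :
      (forall a h k, {ae P, forall w, Y w (a *: h + k) = a * Y w h + Y w k}) ->
      {ae P, forall w, W (Y w) = W (Y w) * cos (Y w 0 + 0)}.
    (* Linearity at zero reads Y 0 = Y 0 + Y 0, hence Y 0 = 0 almost surely. *)
    move=> lin; have := lin 1 0 0; apply: filterS => w.
    rewrite scaler0 add0r mul1r => /esym/eqP; rewrite -subr_eq0 addrK => /eqP ->.
    by rewrite add0r cos0 mulr1.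
  rewrite (ae_eq_Rintegral mY1 bW b2); last exact: Z.
  by rewrite (ae_eq_Rintegral mY2 bW b2)//; exact: Z.
(* This is the only place where the equality of marginals enters. *)
- move=> h c.
  have mc : measurable_fun setT (fun x : R => (cos (x + c))%:E).
    apply/measurable_EFinP; apply: measurableT_comp.
      by apply: continuous_measurable_fun; exact: continuous_cos.
    exact: measurable_funD.
  have mX d (T : measurableType d) (Y : T -> S) : measurable_fun setT Y ->
      measurable_fun setT (fun w => Y w h : R).
    by move=> mY; exact: (measurableT_comp (measurable_evaluation h) mY).
  have X d (T : measurableType d) (P : probability T R) (Y : T -> S)
      (mY : measurable_fun setT Y) :
      (\int[P]_w (cos (Y w h + c))%:E =
       \int[pushforward P (fun w => Y w h)]_x (cos (x + c))%:E)%E.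
    rewrite integral_pushforward//; first exact: mX.
    by have := @integrable_bounded_comp _ _ P _ mY _ (bounded_measurable_cos1 h c).
  congr fine; rewrite !X//; apply: eq_measure_integral => /=; [exact: mX|exact: mX|].
  by move=> mX2 mX1 B mB _; rewrite /pushforward; exact: law.
Qed.

End cramer_wold.

(** * The Neyman-Pearson bound *)

Section neyman_pearson_1d.
Context {R : realType}.
Implicit Types (k z : R) (B : set R).
Local Notation mu := (@lebesgue_measure R).

Lemma normal_pdf_shift k (x : R) :
  (normal_pdf k 1 x = expR (k * x - k ^+ 2 / 2) * normal_pdf 0 1 x)%R.
Proof.
rewrite !normal_pdfE ?oner_neq0// mulrCA; congr (_ * _)%R.
by rewrite /normal_fun -expRD; congr expR; field.
Qed.

(** The constant is the likelihood ratio at [z]. The ratio is nondecreasing as [k] is nonnegative,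
    so it is at most the constant exactly where the half-line requires. The additive form avoids
    subtraction in the extended reals and can be integrated over sections. *)
Lemma normal_neyman_pearson k z B : (0 <= k)%R -> measurable B ->
  normal_prob k 1%R `]-oo, z] +
    (expR (k * z - k ^+ 2 / 2))%:E * normal_prob 0%R 1%R B <=
  normal_prob k 1%R B +
    (expR (k * z - k ^+ 2 / 2))%:E * normal_prob 0%R 1%R `]-oo, z].
Proof.
move=> k0 mB; set c := expR _; have c0 : (0 <= c)%R by exact: expR_ge0.
have mI : measurable (`]-oo, z]%classic : set R) by exact: measurable_itv.
pose h (A A' : set R) (x : R) : \bar R := (normal_pdf k 1 x)%:E * (\1_A x)%:E +
  c%:E * ((normal_pdf 0 1 x)%:E * (\1_A' x)%:E).
have hE (A A' : set R) : measurable A -> measurable A' ->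
    normal_prob k 1%R A + c%:E * normal_prob 0%R 1%R A' = \int[mu]_x h A A' x.
  move=> mA mA'; rewrite !normal_probE//.
  rewrite -ge0_integralZl//; first last.
  - by move=> x _; exact: pdf_indic_ge0.
  - exact: measurable_pdf_indic.
  rewrite -ge0_integralD//.
  - by move=> x _; exact: pdf_indic_ge0.
  - exact: measurable_pdf_indic.
  - by move=> x _; rewrite mule_ge0// pdf_indic_ge0.
  - by apply: emeasurable_funM => //; exact: measurable_pdf_indic.
have h0 (A A' : set R) x : 0 <= h A A' x.
  by rewrite adde_ge0 ?mule_ge0 ?lee_fin ?normal_pdf_ge0// indicE.
have mh (A A' : set R) : measurable A -> measurable A' -> measurable_fun setT (h A A').
  move=> mA mA'; apply: emeasurable_funD; first exact: measurable_pdf_indic.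
  by apply: emeasurable_funM => //; exact: measurable_pdf_indic.
rewrite !hE//; apply: ge0_le_integral => //; [exact: mh|exact: mh|].
move=> x _; rewrite /h -!EFinM -!EFinD lee_fin !indicE normal_pdf_shift.
have p0 : (0 <= normal_pdf 0 1 x)%R by exact: normal_pdf_ge0.
have [xz|xz] := boolP (x \in _); have [xB|xB] := boolP (x \in B);
  rewrite ?mulr1 ?mulr0 ?addr0 ?add0r//.
- rewrite ler_wpM2r// ler_expR lerD2r ler_wpM2l//.
  by move: xz; rewrite inE/= in_itv.
- rewrite ler_wpM2r// ler_expR lerD2r ler_wpM2l//.
  by move: xz; rewrite notin_setE/= in_itv/= => /negP; rewrite -ltNge => /ltW.
Qed.

End neyman_pearson_1d.

(** * Testing a shift of the noise in one direction *)

Section gaussian_process.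
Context {R : realType} {H : normedModType R} (ip : H -> H -> R).
Hypothesis ipP : forall (a : R) (h k l : H),
  (ip l (a *: h + k) = a * ip l h + ip l k)%R.
Hypothesis ipC : forall h k, ip h k = ip k h.
Hypothesis ip_norm : forall h, (ip h h = `|h| ^+ 2)%R.
Local Notation S := (sample_space R H).

Lemma ip0r h : ip h 0%R = 0%R.
Proof.
have := ipP 1 (0 : H)%R (0 : H)%R h; rewrite scaler0 add0r mul1r => /esym/eqP.
by rewrite -subr_eq0 addrK => /eqP.
Qed.

Lemma ipZr a h k : ip h (a *: k)%R = (a * ip h k)%R.
Proof. by have := ipP a k (0 : H)%R h; rewrite !addr0 ip0r addr0. Qed.

Lemma ipDr h k l : ip h (k + l)%R = (ip h k + ip h l)%R.
Proof. by have := ipP 1 k l h; rewrite scale1r mul1r. Qed.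

Lemma ipNr h k : ip h (- k)%R = (- ip h k)%R.
Proof. by rewrite -scaleN1r ipZr mulN1r. Qed.

Lemma ipBr h k l : ip h (k - l)%R = (ip h k - ip h l)%R.
Proof. by rewrite ipDr ipNr. Qed.

Lemma ipZl a h k : ip (a *: h)%R k = (a * ip h k)%R.
Proof. by rewrite ipC ipZr ipC. Qed.

Lemma ipDl h k l : ip (h + k)%R l = (ip h l + ip k l)%R.
Proof. by rewrite ipC ipDr ipC [ip l k]ipC. Qed.

Lemma ipBl h k l : ip (h - k)%R l = (ip h l - ip k l)%R.
Proof. by rewrite ipC ipBr ipC [ip l k]ipC. Qed.

Context d (Omega : measurableType d) (P : probability Omega R)
  (eps : H -> {RV P >-> R}).
Hypothesis eps_gauss : standard_gaussian eps.
Local Notation N := (normal_prob (0%R : R) 1%R).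

Lemma ae_fst (Q : Omega -> Prop) : {ae P, forall w, Q w} ->
  {ae (P \x N)%E, forall p : Omega * measurableTypeR R, Q p.1}.
Proof.
move=> [A [mA PA QA]]; exists (A `*` setT); split.
- exact: measurableX.
- by transitivity (P A * N setT); [exact: product_measure1E|rewrite PA mul0e].
- by move=> [w x] /= nQ; split => //; exact: QA.
Qed.

(* The noise component along the unit vector e, replaced by an independent
   standard normal variable. *)
Definition split_noise (e : H) (p : Omega * measurableTypeR R) : S :=
  fun h => (eps (h - ip e h *: e) p.1 + ip e h * p.2)%R.

Lemma measurable_split_noise e : measurable_fun setT (split_noise e).
Proof.
apply: measurable_fun_sample_space => h.
apply: measurable_funD; last exact: measurable_funM.
by apply: measurableT_comp => //; exact: measurable_funP.
Qed.

Lemma measurable_noise : measurable_fun setT (fun w => (fun h => eps h w) : S).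
Proof. by apply: measurable_fun_sample_space => h; exact: measurable_funP. Qed.

(** Both processes are almost surely linear, and by Pythagoras their marginal variances agree. *)
Lemma noise_law_split (e : H) : `|e|%R = 1%R -> forall A : set S, measurable A ->
  P ((fun w => (fun h => eps h w) : S) @^-1` A) =
  (P \x N)%E (split_noise e @^-1` A).
Proof.
move=> e1; apply: (@linear_process_law_unique R H _ _ P _ _ (P \x N)%E _ _
  measurable_noise (measurable_split_noise e)).
- exact: eps_gauss.2.
- move=> a h k.
  have := ae_fst (eps_gauss.2 a (h - ip e h *: e)%R (k - ip e k *: e)%R).
  apply: filterS => -[w x] /= E; rewrite /split_noise/= ipP.
  rewrite (_ : (_ - _)%R = (a *: (h - ip e h *: e) + (k - ip e k *: e))%R); last first.
    by rewrite scalerBr scalerDl scalerA addrACA opprD.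
  by rewrite E; ring.
- move=> h B mB.
  have -> : P [set w | B (eps h w)] = gaussian 0%R `|h|%R B by rewrite -eps_gauss.1.
  rewrite -(@gaussian_conv _ _ _ P (eps (h - ip e h *: e)%R) `|h|%R (ip e h)
    `|h - ip e h *: e|%R)//; last by move=> *; exact: eps_gauss.1.
  rewrite -!ip_norm ipBr ipBl ipZl ipZr ipBl ipZl (ip_norm e) e1 (ipC h e).
  ring.
Qed.

(** For each [w] the section of the acceptance region is a set of reals, to which the inequality on
    the line applies with the same constant [c]. Integrating over [w] and cancelling the finite term
    against the coverage assumption gives the bound. *)
Lemma neyman_pearson_lower_bound (sigma k z : R) (e : H) (u : S) (A : set S) :
  (0 <= k)%R -> `|e|%R = 1%R -> measurable A ->
  N `]-oo, z] <= P [set w | A (fun h => u h + sigma * eps h w)%R] ->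
  N `]-oo, (z - k)%R] <=
    P [set w | A (fun h => u h + sigma * k * ip e h + sigma * eps h w)%R].
Proof.
move=> k0 e1 mA cov.
have maff (v : S) : measurable_fun setT (fun y : S => (fun h => v h + sigma * y h)%R : S).
  apply: measurable_fun_sample_space => h; apply: measurable_funD => //.
  by apply: measurable_funM => //; exact: measurable_evaluation.
have mpre (v : S) : measurable [set y : S | A (fun h => v h + sigma * y h)%R].
  by rewrite -[X in measurable X]setTI; exact: maff.
pose G := [set p : Omega * measurableTypeR R |
  A (fun h => u h + sigma * split_noise e p h)%R].
have mG : measurable G.
  rewrite -[G]setTI.
  exact: (measurableT_comp (maff u) (measurable_split_noise e) measurableT mA).
have PfE : P [set w | A (fun h => u h + sigma * eps h w)%R] =
    \int[P]_w N (xsection G w) by exact: (noise_law_split e1 (mpre u)).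
have PgE : P [set w | A (fun h => u h + sigma * k * ip e h + sigma * eps h w)%R] =
    \int[P]_w normal_prob k 1%R (xsection G w).
  have := noise_law_split e1 (mpre (fun h => u h + sigma * k * ip e h)%R).
  (* The drift along [e] is absorbed by replacing the added normal variable x by x + k. *)
  move=> ->; apply: eq_integral => w _ /=.
  rewrite -(@normal_prob_shift _ k); last exact: (measurable_xsection w mG).
  congr (normal_prob _ _ _); apply/seteqP; split => x; rewrite /xsection/= !inE/= /G/= => h;
    congr (A _): h; apply/funext => l; rewrite /split_noise/=; ring.
set c := expR (k * z - k ^+ 2 / 2).
have mN m : measurable_fun setT (fun w => normal_prob m 1%R (xsection G w)).
  exact: measurable_fun_xsection.
have : \int[P]_w (normal_prob k 1%R `]-oo, z] + c%:E * N (xsection G w)) <=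
       \int[P]_w (normal_prob k 1%R (xsection G w) + c%:E * N `]-oo, z]).
  apply: ge0_le_integral => //.
  - by move=> w _; rewrite adde_ge0// mule_ge0// lee_fin expR_ge0.
  - by apply: emeasurable_funD => //; apply: emeasurable_funM => //; exact: mN.
  - by apply: emeasurable_funD => //; exact: mN.
  - by move=> w _; apply: normal_neyman_pearson => //; exact: (measurable_xsection w mG).
have c0 : 0 <= c%:E by rewrite lee_fin expR_ge0.
have mcN : measurable_fun setT (fun w => c%:E * N (xsection G w)).
  by apply: emeasurable_funM => //; exact: mN.
have cN0 w : 0 <= c%:E * N (xsection G w) by rewrite mule_ge0.
rewrite (ge0_integralD _ measurableT _ _ _ mcN)// (ge0_integralD _ measurableT _ (mN k))//;
  last by move=> w _; rewrite mule_ge0.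
rewrite (ge0_integralZl _ measurableT (mN 0%R))//.
have cstI (r : \bar R) : \int[P]_w r = r.
  rewrite integral_cst// -[RHS]mule1; congr (_ * _); exact: probability_setT.
rewrite !cstI -PfE -PgE => le1.
have zk : normal_prob k 1%R `]-oo, z] = N `]-oo, (z - k)%R].
  rewrite -(@normal_prob_shift _ k)//; congr (normal_prob _ _ _).
  by apply/seteqP; split => x /=; rewrite !in_itv/= lerBrDr.
rewrite -zk.
have fin : c%:E * N `]-oo, z] \is a fin_num by rewrite fin_numM// fin_num_measure.
rewrite -(leeD2rE _ _ fin); apply: le_trans le1; rewrite leeD2l//.
by rewrite lee_wpmul2l.
Qed.

End gaussian_process.

(** * The distance to the null *)

Section convex_symmetric.
Local Open Scope ring_scope.
Context {R : realType} {V : lmodType R} (F : set V).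
Hypothesis F_convex : convex_set (F : set (convex_lmodType V)).

Lemma convex_set_comb (t : R) (x y : V) : 0 <= t -> t <= 1 -> F x -> F y ->
  F (t *: x + (1 - t) *: y).
Proof.
move=> t0 t1 Fx Fy.
have xF : (x : convex_lmodType V) \in (F : set (convex_lmodType V)) by rewrite inE.
have yF : (y : convex_lmodType V) \in (F : set (convex_lmodType V)) by rewrite inE.
by have := F_convex (Itv01 t0 t1) xF yF; rewrite inE.
Qed.

Hypothesis F_sym : forall f : V, F f -> F (- f).

(** [c *: x] is the mixture of x and -x with weight (1 + c) / 2 on x. *)
Lemma convex_sym_scale (c : R) (x : V) : `|c| <= 1 -> F x -> F (c *: x).
Proof.
rewrite ler_norml => /andP[c0 c1] Fx.
have h0 : 0 <= (1 + c) / 2 by lra.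
have h1 : (1 + c) / 2 <= 1 by lra.
have := convex_set_comb h0 h1 Fx (F_sym Fx); congr F.
by rewrite scalerN -scalerBl; congr (_ *: _); field.
Qed.

Lemma convex_sym_half (x y : V) : F x -> F y -> F (2^-1 *: (x - y)).
Proof.
move=> Fx Fy; have h0 : (0 : R) <= 2^-1 by lra.
have h1 : (2^-1 : R) <= 1 by lra.
have := convex_set_comb h0 h1 Fx (F_sym Fy); congr F.
by rewrite scalerBr scalerN; congr (_ - _ *: _); field.
Qed.

End convex_symmetric.

Section distance_function.
Local Open Scope ring_scope.
Context {R : realType} {V : lmodType R} {H : normedModType R} (ip : H -> H -> R).
Hypothesis ipP : forall (a : R) (h k l : H),
  ip l (a *: h + k) = a * ip l h + ip l k.
Hypothesis ipC : forall h k, ip h k = ip k h.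
Hypothesis ip_norm : forall h, ip h h = `|h| ^+ 2.
Context (F : set V) (K : {linear V -> H}) (L : {scalar V}).
Hypothesis F_convex : convex_set (F : set (convex_lmodType V)).
Hypothesis F_sym : forall f : V, F f -> F (- f).
Hypothesis modulus_attained : forall delta : R, 0 < delta ->
  exists f g, modulus_maximizer F K L delta f g.
Variable hs : R -> V.
Hypothesis F_hs : forall tau, F (hs tau).
Hypothesis L_hs : forall tau, L (hs tau) = tau.
Hypothesis hs_min : forall h, F h -> `|K (hs (L h))| <= `|K h|.

Let LN x : L (- x) = - L x. Proof. by rewrite raddfN. Qed.
Let LB x y : L (x - y) = L x - L y. Proof. by rewrite raddfB. Qed.
Let KN x : K (- x) = - K x. Proof. by rewrite raddfN. Qed.

Definition distance (tau : R) : R := `|K (hs tau)|.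

Lemma distance_ge0 tau : 0 <= distance tau. Proof. exact: normr_ge0. Qed.

Lemma distance_le h : F h -> distance (L h) <= `|K h|.
Proof. exact: hs_min. Qed.

Lemma distanceN tau : distance (- tau) = distance tau.
Proof.
have le1 (t : R) : distance (- t) <= distance t.
  by have := distance_le (F_sym (F_hs t)); rewrite LN L_hs KN normrN.
by apply/le_anti/andP; split => //; rewrite -{1}[tau]opprK.
Qed.

Lemma distance_norm tau : distance `|tau| = distance tau.
Proof. by have [_|_] := ger0P tau; rewrite ?distanceN. Qed.

(** Scaling [hs tau'] by [tau / tau'] keeps it in [F] and does not enlarge its image. *)
Lemma distance_homo tau tau' : `|tau| <= `|tau'| -> distance tau <= distance tau'.
Proof.
move=> tt; have [t'0|t'0] := eqVneq tau' 0.
  by move: tt; rewrite t'0 normr0 normr_le0 => /eqP ->.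
have c1 : `|tau / tau'| <= 1 by rewrite normf_div ler_pdivrMr ?mul1r ?normr_gt0.
have := distance_le (convex_sym_scale F_convex F_sym c1 (F_hs tau')).
rewrite !linearZ/= L_hs mulrVK ?unitfE// => /le_trans; apply.
by rewrite normrZ ler_piMl.
Qed.

Lemma measurable_distance : measurable_fun setT distance.
Proof.
(* Truncation at 0 produces a function that is monotone on the whole line. *)
have -> : distance = (fun t => distance (Num.max 0 t)) \o (fun t : R => `|t|).
  by apply/funext => t /=; rewrite (max_idPr _)// distance_norm.
apply: measurableT_comp; last exact: normr_measurable.
apply: nondecreasing_measurable => // x y xy; apply: distance_homo.
have max0 (t : R) : 0 <= Num.max 0 t by rewrite le_max lexx.
by rewrite !ger0_norm// ge_max max0 le_max xy orbT.
Qed.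

(** By convexity and symmetry a pair in the modulus may be replaced by (-h, h), with h half its
    difference. Attainment of the modulus makes the sublevel set of the distance a closed bounded
    interval. *)
Lemma modulus_ball (delta : R) : 0 < delta -> exists m : R,
  [/\ 0 <= m, modulus F K L (2 * delta) = (m + m)%:E &
      forall tau, (distance tau <= delta) = (`|tau| <= m)].
Proof.
move=> d0; have d2 : 0 < 2 * delta by lra.
have [f [g [Ff Fg fgd fgE]]] := modulus_attained d2.
pose m := (L g - L f) / 2.
have mE : L g - L f = m + m by rewrite /m; field.
have le_m tau : distance tau <= delta -> tau <= m.
  move=> td; suff : ((tau + tau)%:E <= modulus F K L (2 * delta))%E.
    by rewrite -fgE lee_fin mE; lra.
  (* The symmetric pair competes in the modulus at 2 delta and has gap 2 tau. *)
  apply: ereal_sup_ubound; exists (- hs tau, hs tau) => /=.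
    split; last by split => //; exact: F_sym.
    rewrite opprK raddfD (le_trans (ler_normD _ _))//.
    by move: td; rewrite /distance; lra.
  by rewrite /= LN L_hs opprK.
exists m; split.
- apply: le_m; rewrite (_ : 0 = L 0); last by rewrite raddf0.
  have F0 : F 0.
    by have := convex_sym_half F_convex F_sym (F_hs 0) (F_hs 0); rewrite subrr scaler0.
  by rewrite (le_trans (distance_le F0))// raddf0 normr0 ltW.
- by rewrite -fgE mE.
- move=> tau; apply/idP/idP => [td|tm].
    by rewrite ler_norml lerNl !le_m// distanceN.
  have hF := convex_sym_half F_convex F_sym Fg Ff.
  have hm : L (2^-1 *: (g - f)) = m.
    by rewrite linearZ/= raddfB /m mulrC.
  have : `|K (2^-1 *: (g - f))| <= delta.
    rewrite linearZ normrZ gtr0_norm ?invr_gt0// mulrC ler_pdivrMr//.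
    by rewrite mulrC.
  apply: le_trans; apply: le_trans (distance_le hF); rewrite hm.
  by apply: distance_homo; rewrite (le_trans tm)// ler_norm.
Qed.

(** The modulus is attained, hence finite, so sublevel sets of the distance are bounded. This later
    supplies a nonzero vector in the image of [K]. *)
Lemma distance_unbounded (delta : R) : exists tau, delta < distance tau.
Proof.
have d0 : 0 < Num.max 1 delta by rewrite lt_max ltr01.
have [m [m0 _ mE]] := modulus_ball d0.
exists (m + 1); rewrite ltNge; apply/negP => h.
have : distance (m + 1) <= Num.max 1 delta by rewrite le_max h orbT.
by rewrite mE ger0_norm; lra.
Qed.

(** Closed sublevel intervals make the distance left-continuous at |tau|, so rational values
    suffice; this gives the countable family of test directions. *)
Lemma distance_left_approx (tau eta : R) : 0 < distance tau -> 0 < eta ->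
  exists q : rat, [/\ 0 < ratr q :> R, ratr q < `|tau|, 0 < distance (ratr q) &
    distance tau - eta < distance (ratr q)].
Proof.
(* The second term keeps the level positive when [eta] is large. *)
move=> t0 e0; pose delta := Num.max (distance tau - eta) (distance tau / 2).
have d0 : 0 < delta by rewrite lt_max (_ : 0 < _ / _) ?orbT//; lra.
have dt : delta < distance tau by rewrite gt_max; apply/andP; split; lra.
have [m [m0 _ mE]] := modulus_ball d0.
have mt : m < `|tau| by rewrite ltNge -mE -ltNge.
have [q] := rat_in_itvoo mt; rewrite in_itv/= => /andP[mq qt].
have q0 : 0 < ratr q :> R by exact: le_lt_trans mq.
have dq : delta < distance (ratr q).
  by rewrite ltNge mE -ltNge (lt_le_trans mq)// ler_norm.
exists q; split => //; first exact: lt_trans dq.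
by apply: le_lt_trans dq; rewrite le_max lexx.
Qed.

(* [hs r] is the point of the convex set {h in F, L h >= r} closest to 0. *)
Lemma distance_projection (r : R) (h : V) : 0 < r -> F h -> r <= L h ->
  distance r ^+ 2 <= ip (K (hs r)) (K h).
Proof.
move=> r0 Fh rh; set a := K (hs r); set b := K h.
(* The segment from [hs r] to [h] stays in [F] at values of [L] at least r, so the squared norm
   along it is never below its initial value; the increment is divided by t. *)
have key (t : R) : 0 < t -> t <= 1 -> 0 <= 2 * ip a (b - a) + t * ip (b - a) (b - a).
  move=> t0 t1; pose ft := t *: h + (1 - t) *: hs r.
  have Fft : F ft by apply: convex_set_comb => //; exact: ltW.
  have Lft : r <= L ft.
    rewrite raddfD/= !linearZ/= L_hs -subr_ge0.
    have -> : t * L h + (1 - t) * r - r = t * (L h - r) by ring.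
    by rewrite mulr_ge0 ?subr_ge0// ltW.
  have : distance r <= `|K ft|.
    apply: le_trans (distance_le Fft); apply: distance_homo.
    by rewrite !ger0_norm// ?(le_trans (ltW r0))// ltW.
  rewrite -(@ler_pXn2r _ 2)// ?nnegrE ?distance_ge0 ?normr_ge0//.
  have -> : K ft = a + t *: (b - a).
    rewrite /ft raddfD/= !linearZ/= -/a -/b scalerBr scalerBl scale1r.
    by rewrite addrC -addrA; congr (_ + _); rewrite addrC.
  rewrite /distance -/a -!ip_norm; move: (b - a) => v.
  rewrite (ipDl ipP ipC) !(ipDr ipP) !(ipZl ipP ipC) !(ipZr ipP) (ipC v a) => le1.
  rewrite -(pmulr_rge0 _ t0).
  by nra.
have ab : 0 <= ip a (b - a).
  rewrite leNgt; apply/negP => x0.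
  set x := ip a (b - a) in key x0; set D := ip (b - a) (b - a) in key.
  have D0 : 0 <= D by rewrite /D ip_norm sqr_ge0.
  have D1 : 0 < D + 1 by lra.
  (* This t gives t D < -x, so 2 x + t D is negative, against [key]. *)
  pose t := Num.min 1 (- x / (D + 1)).
  have t0 : 0 < t by rewrite lt_min ltr01 divr_gt0// oppr_gt0.
  have t1 : t <= 1 by rewrite ge_min lexx.
  have tx : t * (D + 1) <= - x by rewrite -ler_pdivlMr// ge_min lexx orbT.
  have := key t t0 t1; nra.
move: ab; rewrite (ipBr ipP) subr_ge0 ip_norm /distance -/a.
by [].
Qed.

End distance_function.

(** * Bounds on the expected length *)

Section measurable_comparison.
Context {R : realType} d (T : measurableType d).
Implicit Types f g : T -> R.

Lemma measurable_set_lt f g : measurable_fun setT f -> measurable_fun setT g ->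
  measurable [set x | (f x < g x)%R].
Proof.
move=> mf mg; have mh : measurable_fun setT (fun x => g x - f x)%R.
  exact: measurable_funB.
have := mh measurableT _ (measurable_itv `]0%R, +oo[).
rewrite setTI; congr measurable; apply/seteqP; split => x /=;
  by rewrite in_itv/= andbT subr_gt0.
Qed.

Lemma measurable_set_le f g : measurable_fun setT f -> measurable_fun setT g ->
  measurable [set x | (f x <= g x)%R].
Proof.
move=> mf mg; have mh : measurable_fun setT (fun x => g x - f x)%R.
  exact: measurable_funB.
have := mh measurableT _ (measurable_itv `[0%R, +oo[).
rewrite setTI; congr measurable; apply/seteqP; split => x /=;
  by rewrite in_itv/= andbT subr_ge0.
Qed.

Lemma measurable_set_eq f (r : R) : measurable_fun setT f ->
  measurable [set x | f x = r].
Proof.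
by move=> mf; have := mf measurableT _ (measurable_set1 r); rewrite setTI.
Qed.

Lemma measurable_sg : measurable_fun setT (Num.sg : R -> R).
Proof.
apply: nondecreasing_measurable => // x y xy.
by case: (sgrP x) => [x0|x0|x0]; case: (sgrP y) => [y0|y0|y0]; lra.
Qed.

Lemma measure_sections d2 (T2 : measurableType d2)
    (m1 : {sigma_finite_measure set T -> \bar R})
    (m2 : {sigma_finite_measure set T2 -> \bar R}) (D : set (T * T2)) :
  measurable D ->
  \int[m1]_x m2 (xsection D x) = \int[m2]_y m1 (ysection D y).
Proof.
move=> mD; have := indic_fubini_tonelli m1 m2 mD.
by rewrite indic_fubini_tonelli_FE// indic_fubini_tonelli_GE.
Qed.

End measurable_comparison.

Section expected_length_bounds.
Context {R : realType} {V : lmodType R} {H : normedModType R} (ip : H -> H -> R).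
Hypothesis ipP : forall (a : R) (h k l : H),
  (ip l (a *: h + k) = a * ip l h + ip l k)%R.
Hypothesis ipC : forall h k, ip h k = ip k h.
Hypothesis ip_norm : forall h, (ip h h = `|h| ^+ 2)%R.
Context (F : set V) (K : {linear V -> H}) (L : {scalar V}).
Hypothesis F_convex : convex_set (F : set (convex_lmodType V)).
Hypothesis F_sym : forall f : V, F f -> F (- f)%R.
Hypothesis modulus_attained : forall delta : R, (0 < delta)%R ->
  exists f g, modulus_maximizer F K L delta f g.
Variable hs : R -> V.
Hypothesis F_hs : forall tau, F (hs tau).
Hypothesis L_hs : forall tau, L (hs tau) = tau.
Hypothesis hs_min : forall h, F h -> (`|K (hs (L h))| <= `|K h|)%R.
Variable g : V.
Hypothesis F_sub : forall f : V, F f -> F (f - g)%R.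
Context (sigma alpha : R).
Hypothesis sigma_gt0 : (0 < sigma)%R.
Hypothesis alpha_gt0 : (0 < alpha)%R.
Hypothesis alpha_lt1 : (alpha < 1)%R.
Context d (Omega : measurableType d) (P : probability Omega R)
  (eps : H -> {RV P >-> R}).
Hypothesis eps_gauss : standard_gaussian eps.
Local Notation N := (normal_prob (0%R : R) 1%R).
Local Notation z := (z_quantile (1 - alpha)%R).
Local Notation S := (sample_space R H).
Local Notation rho := (distance K hs).
Local Notation mu := (@lebesgue_measure R).
Local Notation Y := (observation ip K sigma eps).

Let LB x y : L (x - y)%R = (L x - L y)%R. Proof. by rewrite raddfB. Qed.
Let LD x y : L (x + y)%R = (L x + L y)%R. Proof. by rewrite raddfD. Qed.
Let KD x y : K (x + y)%R = (K x + K y)%R. Proof. by rewrite raddfD. Qed.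
Let KB x y : K (x - y)%R = (K x - K y)%R. Proof. by rewrite raddfB. Qed.

Let F_add f : F f -> F (g + f)%R.
Proof.
move=> Ff; have := F_sym (F_sub (F_sym Ff)).
by rewrite opprB opprK.
Qed.

Let cdf_z : normal_cdf z = (1 - alpha)%R.
Proof. by apply: normal_cdf_z_quantile; [rewrite subr_gt0|rewrite gtrBl]. Qed.

Let N_z : N `]-oo, z] = (1 - alpha)%:E.
Proof. by rewrite -normal_cdfE cdf_z. Qed.

Let unit_vector : exists e : H, `|e|%R = 1%R.
Proof.
have [tau tau0] := distance_unbounded F_convex F_sym modulus_attained F_hs L_hs hs_min 0.
exists ((rho tau)^-1 *: K (hs tau))%R.
by rewrite normrZ gtr0_norm ?invr_gt0// mulVf// gt_eqF.
Qed.

(* The probability under g that the most powerful level-alpha test of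
   L f = theta against g accepts. *)
Definition acceptance (theta : R) : R := normal_cdf (z - rho (theta - L g) / sigma).

Lemma measurable_acceptance : measurable_fun setT acceptance.
Proof.
apply: (measurableT_comp measurable_normal_cdf).
apply: measurable_funB => //; apply: measurable_funM => //.
apply: measurableT_comp; first exact: (measurable_distance F_convex F_sym F_hs L_hs hs_min).
exact: measurable_funB.
Qed.

Lemma measurable_observation f : measurable_fun setT (Y f).
Proof.
apply: measurable_fun_sample_space => h; apply: measurable_funD => //.
by apply: measurable_funM => //; exact: measurable_funP.
Qed.

Lemma measurable_observed_set (C : S -> set R) :
  measurable [set p : S * R | C p.1 p.2] ->
  measurable [set p : Omega * measurableTypeR R | C (Y g p.1) p.2].
Proof.
move=> mC; set D := [set p | _]; rewrite -[D]setTI.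
have mh : measurable_fun setT (fun p : Omega * measurableTypeR R => (Y g p.1, p.2 : R)).
  apply/measurable_fun_pairP; split; last exact: measurable_snd.
  exact: (measurableT_comp (measurable_observation g) measurable_fst).
exact: (mh measurableT _ mC).
Qed.

Lemma expected_length_sections (C : S -> set R) :
  measurable [set p : S * R | C p.1 p.2] ->
  expected_length ip K sigma eps g C = \int[mu]_theta P [set w | C (Y g w) theta].
Proof.
move=> mC; pose D := [set p : Omega * measurableTypeR R | C (Y g p.1) p.2].
have mD : measurable D by exact: measurable_observed_set.
transitivity (\int[P]_w mu (xsection D w)).
  apply: eq_integral => w _; congr (lebesgue_measure _).
  by apply/seteqP; split => x; rewrite /xsection/= inE.
rewrite (measure_sections P mu mD); apply: eq_integral => theta _.
by congr (P _); apply/seteqP; split => x; rewrite /ysection/= inE.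
Qed.

Lemma expected_length_lower_bound (C : S -> set R) :
  confidence_sets ip F K L sigma eps alpha C ->
  \int[mu]_theta (acceptance theta)%:E <= expected_length ip K sigma eps g C.
Proof.
move=> [mC cov]; rewrite expected_length_sections//.
have mA theta : measurable [set y | C y theta].
  rewrite (_ : [set y | C y theta] = ysection [set p : S * R | C p.1 p.2] theta).
    exact: measurable_ysection.
  by apply/seteqP; split => x; rewrite /ysection/= inE.
apply: ge0_le_integral => //.
- by move=> theta _; rewrite lee_fin fine_ge0.
- by apply/measurable_EFinP; exact: measurable_acceptance.
- pose D := [set p : Omega * measurableTypeR R | C (Y g p.1) p.2].
  have mD : measurable D by exact: measurable_observed_set.
  have := measurable_fun_ysection P mD; congr (measurable_fun _ _).
  apply/funext => theta /=; congr (P _).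
  by apply/seteqP; split => x; rewrite /ysection/= inE.
move=> theta _; rewrite normal_cdfE.
(* The null point whose image is nearest to [K g], hence the hardest to tell from [g]. *)
pose f := (g + hs (theta - L g))%R.
have Ff : F f by exact: F_add.
have Lf : L f = theta by rewrite LD L_hs addrC subrK.
have covf : N `]-oo, z] <= P [set w | C (Y f w) theta].
  rewrite N_z -Lf; apply: (le_trans cov); apply: ereal_inf_lbound.
  by exists f.
pose r := rho (theta - L g).
have r0 : (0 <= r / sigma)%R by rewrite divr_ge0 ?distance_ge0// ltW.
(* [K g - K f] is written as r times a unit vector; for r = 0 any unit vector serves. *)
have [e e1 eE] : exists2 e : H, `|e|%R = 1%R & K (- hs (theta - L g))%R = (r *: e)%R.
  have [r00|r00] := eqVneq r 0%R.
    have [e e1] := unit_vector; exists e => //.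
    by rewrite r00 scale0r; apply/eqP; rewrite -normr_eq0 raddfN normrN -/(rho _) -/r r00.
  exists (r^-1 *: K (- hs (theta - L g)))%R.
    by rewrite normrZ normfV raddfN normrN -/(rho _) -/r ger0_norm ?mulVf// distance_ge0.
  by rewrite scalerA divff// scale1r.
have := neyman_pearson_lower_bound ipP ipC ip_norm eps_gauss r0 e1 (mA theta) covf.
move=> /le_trans; apply; rewrite le_eqVlt; apply/orP; left; apply/eqP.
congr (P _); apply/funext => w /=; congr (C _ theta); apply/funext => h.
rewrite /observation; congr (_ + _)%R.
rewrite mulrCA divff ?gt_eqF// mulr1 -(ipZl ipP ipC) -eE -(ipDl ipP ipC) -KD.
by rewrite addrK.
Qed.

Lemma modulus_integral d' (Omega' : measurableType d') (P' : probability Omega' R)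
    (Z : {RV P' >-> R}) :
  (forall B, measurable B -> distribution P' Z B = N B) ->
  \int[P']_(w in [set w | (Z w <= z)%R]) modulus F K L (2 * sigma * (z - Z w)) =
  \int[mu]_theta (acceptance theta)%:E.
Proof.
move=> Z_normal.
have mZ : measurable_fun setT Z by exact: measurable_funP.
have mZ1 : measurable_fun setT (fun p : Omega' * measurableTypeR R => Z p.1 : R).
  exact: (measurableT_comp mZ measurable_fst).
have mrho : measurable_fun setT
    (fun p : Omega' * measurableTypeR R => rho (p.2 - L g)).
  apply: measurableT_comp; first exact: (measurable_distance F_convex F_sym F_hs L_hs hs_min).
  exact: measurable_funB.
(* For Z < z the section of [D] over theta is a closed interval whose length is the modulus; its
   section over Omega' has probability [acceptance theta]. *)
pose D := [set p : Omega' * measurableTypeR R |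
  (rho (p.2 - L g) <= sigma * (z - Z p.1))%R].
have mD : measurable D.
  apply: measurable_set_le => //; apply: measurable_funM => //.
  exact: measurable_funB.
have mS := measurable_fun_xsection mu mD.
set A := [set w | (Z w <= z)%R].
have mA : measurable A by exact: measurable_set_le.
have mA1 : measurable [set w | (Z w < z)%R] by exact: measurable_set_lt.
have mA2 : measurable [set w | Z w = z] by exact: measurable_set_eq.
have secE w : (Z w < z)%R ->
    mu (xsection D w) = modulus F K L (2 * sigma * (z - Z w)).
  move=> wz; have d0 : (0 < sigma * (z - Z w))%R by rewrite mulr_gt0// subr_gt0.
  have [m [m0 mE ball]] :=
    modulus_ball F_convex F_sym modulus_attained F_hs L_hs hs_min d0.
  rewrite -mulrA mE (_ : xsection D w = `[(L g - m)%R, (L g + m)%R]%classic); last first.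
    apply/seteqP; split => x; rewrite /xsection/= inE/= /D/= in_itv/=.
      by rewrite ball ler_norml lerBlDr lerBrDr => /andP[? ?]; apply/andP; split; lra.
    by rewrite ball ler_norml => /andP[? ?]; apply/andP; split; lra.
  rewrite lebesgue_measure_itv/= lte_fin -EFinB.
  by case: ltP => // h; congr EFin; lra.
transitivity (\int[P']_w mu (xsection D w)); last first.
  rewrite (measure_sections P' mu mD); apply: eq_integral => theta _.
  rewrite /acceptance normal_cdfE -Z_normal//; congr (P' _).
  apply/seteqP; split => w; rewrite /ysection/= inE/= /D/= in_itv/=.
    rewrite -ler_pdivrMl// => h; rewrite mulrC; lra.
  by rewrite -ler_pdivrMl// mulrC => h; lra.
rewrite [RHS](_ : _ = \int[P']_(w in A) mu (xsection D w)); last first.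
  rewrite [RHS]integral_mkcond; apply: eq_integral => w _; rewrite patchE.
  case: ifPn => //; rewrite notin_setE /A/= => /negP; rewrite -ltNge => zw.
  rewrite (_ : xsection D w = set0) ?measure0//.
  apply/seteqP; split => x //=; rewrite /xsection/= inE/= /D/= => h.
  have := le_trans (distance_ge0 K hs (x - L g)) h.
  by rewrite pmulr_rge0// subr_ge0 leNgt zw.
(* At Z = z the modulus is taken at 0, outside the range of [modulus_ball]; this event is null. *)
apply: ae_eq_integral => //.
- have -> : A = [set w | (Z w < z)%R] `|` [set w | Z w = z].
    apply/seteqP; split => w /=; rewrite /A/=.
      by rewrite le_eqVlt => /orP[/eqP ->|]; [right|left].
    by case=> [/ltW//|->].
  apply/measurable_funU => //; split.
    apply: (eq_measurable_fun (fun w => mu (xsection D w))).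
      by move=> w; rewrite inE => /secE.
    exact: measurable_funS mS.
  apply: (eq_measurable_fun (cst (modulus F K L 0))) => //.
  by move=> w; rewrite inE/= => ->; rewrite subrr mulr0.
- exact: measurable_funS mS.
- exists [set w | Z w = z]; split => //.
    rewrite -(normal_prob_set1 0 1 z) -Z_normal//.
  move=> w /=; apply: contra_notP => wz; rewrite /A/= le_eqVlt => /orP[/eqP//|].
  by move=> /secE.
Qed.

Lemma noise_prob (h : H) (t : R) (B : set R) : t != 0%R -> `|t|%R = `|h|%R ->
  measurable B -> P [set w | B (eps h w)] = N [set x | B (t * x)%R].
Proof.
move=> t0 th mB; rewrite -[LHS]/(distribution P (eps h) B) eps_gauss.1//.
rewrite /gaussian -th normr_eq0 (negbTE t0).
have := @normal_prob_affine _ t 0 0 1 B t0 (oner_neq0 _) mB.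
rewrite mulr0 addr0 mulr1 => E; transitivity (normal_prob 0%R t B).
  by have [_|_] := ger0P t; rewrite ?normal_probNs.
rewrite -E; congr (normal_prob _ _ _).
by apply/seteqP; split => x /=; rewrite addr0.
Qed.

Lemma one_sided_prob (k : H) (s a : R) : (0 < `|k|)%R -> (s * s = 1)%R ->
  P [set w | (a <= s * (sigma * eps k w))%R] =
  N `]-oo, (- a / (sigma * `|k|))%R].
Proof.
move=> k0 ss; have s0 : s != 0%R.
  by apply/eqP => s00; move: ss; rewrite s00 mul0r => /eqP; rewrite eq_sym oner_eq0.
have s1 : `|s|%R = 1%R.
  by apply/eqP; rewrite -sqr_norm_eq1 expr2 ss.
(* The sign of the scale is chosen so that the event becomes a left half-line. *)
have t0 : (- s * `|k| != 0)%R by rewrite mulf_neq0 ?oppr_eq0// gt_eqF.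
rewrite (@noise_prob k (- s * `|k|)%R [set y | (a <= s * (sigma * y))%R])//; last 2 first.
- by rewrite normrM normrN s1 mul1r normr_id.
- apply: measurable_set_le => //.
  by apply: measurable_funM => //; exact: measurable_funM.
congr (normal_prob _ _ _); apply/seteqP; split => x /=; rewrite in_itv/=;
  rewrite ler_pdivlMr ?mulr_gt0//;
  (have -> : (s * (sigma * (- s * `|k| * x)) = - (s * s) * (x * (sigma * `|k|)))%R by ring);
  by rewrite ss mulN1r lerNr.
Qed.

(** Accepting away from the centre covers at least 1 - alpha for every mean [u], by the shift
    inequality, and exactly that much at mean 0. *)
Lemma two_sided_prob (e : H) (c u : R) : `|e|%R = 1%R -> (0 <= c)%R ->
  N [set x | `|x| <= c]%R = alpha%:E ->
  (1 - alpha)%:E <= P [set w | (sigma * c < `|u + sigma * eps e w|)%R] /\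
  (u = 0%R -> P [set w | (sigma * c < `|u + sigma * eps e w|)%R] = (1 - alpha)%:E).
Proof.
move=> e1 c0 cE.
have m1 (v : R) : measurable_fun setT (fun x : R => `|v + sigma * x|%R).
  by apply: measurableT_comp => //; apply: measurable_funD.
have -> : P [set w | (sigma * c < `|u + sigma * eps e w|)%R] =
    N (~` [set x | `|x + u / sigma| <= c]%R).
  rewrite (@noise_prob e 1 [set y | (sigma * c < `|u + sigma * y|)%R])//; last 2 first.
  - by rewrite e1 normr1.
  - exact: measurable_set_lt.
  congr (normal_prob _ _ _); apply/seteqP; split => x /=;
    (have -> : (u + sigma * (1 * x) = sigma * (x + u / sigma))%R by field; rewrite gt_eqF);
    rewrite normrM (gtr0_norm sigma_gt0) ltr_pM2l// ltNge; by move/negP.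
have mB v : measurable [set x : R | `|x + v| <= c]%R.
  apply: measurable_set_le => //; apply: measurableT_comp => //.
  exact: measurable_funD.
have -> : N (~` [set x | `|x + u / sigma| <= c]%R) =
    1 - N [set x | `|x + u / sigma| <= c]%R by exact: (probability_setC N (mB _)).
split.
  by rewrite EFinB leeB// -cE; exact: normal_prob_itvcc_shift.
move=> ->; rewrite mul0r EFinB -cE; congr (_ - normal_prob _ _ _).
by apply/seteqP; split => x /=; rewrite addr0.
Qed.

(** * A jointly measurable confidence set with small excess length *)

Section near_optimal_set.
Variables (e : H) (c kappa : R).
Hypothesis e1 : `|e|%R = 1%R.
Hypothesis c_ge0 : (0 <= c)%R.
Hypothesis cE : N [set x | `|x| <= c]%R = alpha%:E.
Hypothesis kappa_gt0 : (0 < kappa)%R.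

Let q (n : nat) : R := if @unpickle rat n is Some r then ratr r else 0%R.
Let k (n : nat) : H := K (hs (q n)).
(** Any positive weight of finite integral would do; a normal density has integral 1, so the slack
    [kappa * w] integrates to [kappa]. *)
Let w (theta : R) : R := normal_pdf (L g) 1 theta.

Let good (n : nat) : set R := [set theta | [/\ (0 < q n)%R,
  (q n < `|theta - L g|)%R, (0 < rho (q n))%R &
  (rho (theta - L g) - kappa * w theta < rho (q n))%R]].

(** Taking the least good index makes the choice of direction measurable and unique. *)
Let selected (n : nat) : set R := good n `\` \bigcup_(m in `I_n) good m.

(** The noise in this statistic has deviation sigma rho(q n). The statistic has mean at least rho(q
    n)^2 under the null and 0 under [g], which gives coverage at least 1 - alpha and accepting
    probability Phi(z - rho(q n) / sigma) under [g]. *)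
Let accepted (n : nat) : set (S * R) := [set p |
  (rho (q n) ^+ 2 - sigma * z * rho (q n) <=
   Num.sg (p.2 - L g) * (p.1 (k n) - ip (K g) (k n)))%R].

(* For [rho = 0] the test rejects when [y e] is close to its mean under g; this
   is where the level is exactly alpha at g and at most alpha on the null
   (the usual one-sided test has no direction to use). For [rho > 0] the
   direction of the one-sided test is taken from a countable family, which
   makes the confidence set jointly measurable. *)
Let near_optimal : S -> set R := fun y => [set theta |
  (rho (theta - L g) = 0%R /\ (sigma * c < `|y e - ip (K g) e|)%R) \/
  exists2 n, selected n theta & accepted n (y, theta)].

Let rho_homo (t u : R) : (`|t| <= `|u|)%R -> (rho t <= rho u)%R.
Proof. exact: (distance_homo F_convex F_sym F_hs L_hs hs_min). Qed.

Let w_gt0 theta : (0 < w theta)%R.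
Proof.
rewrite /w normal_pdfE ?oner_neq0// mulr_gt0 ?normal_peak_gt0 ?oner_neq0//.
exact: expR_gt0.
Qed.

Let good_rho n theta : good n theta -> (rho (q n) <= rho (theta - L g))%R.
Proof.
move=> [q0 qt _ _]; apply: rho_homo; rewrite ger0_norm; exact: ltW.
Qed.

Let ex_selected theta : (0 < rho (theta - L g))%R -> exists n, selected n theta.
Proof.
move=> r0; have kw : (0 < kappa * w theta)%R by rewrite mulr_gt0.
have [r [r1 r2 r3 r4]] := distance_left_approx F_convex F_sym modulus_attained
  F_hs L_hs hs_min r0 kw.
have ex : exists n, `[< good n theta >].
  exists (pickle r); apply/asboolP; rewrite /good/= /q pickleK.
  by split.
exists (ex_minn ex); case: ex_minnP => n /asboolP gn mn; split => //.
by move=> [m /= mn' /asboolP gm]; move: (mn _ gm); rewrite leqNgt mn'.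
Qed.

Let selected_uniq n m theta : selected n theta -> selected m theta -> n = m.
Proof.
move=> [gn sn] [gm sm]; apply/eqP; rewrite eqn_leq; apply/andP; split.
  by rewrite leqNgt; apply/negP => mn; apply: sn; exists m.
by rewrite leqNgt; apply/negP => mn; apply: sm; exists n.
Qed.

Let measurable_near_optimal : measurable [set p : S * R | near_optimal p.1 p.2].
Proof.
have mtau : measurable_fun setT (fun p : S * R => p.2 - L g)%R.
  by apply: measurable_funB => //; exact: measurable_snd.
have mrho : measurable_fun setT rho.
  exact: (measurable_distance F_convex F_sym F_hs L_hs hs_min).
have mev (h : H) : measurable_fun setT (fun p : S * R => p.1 h : R).
  exact: (measurableT_comp (measurable_evaluation h) measurable_fst).
have mdev (h : H) : measurable_fun setT (fun p : S * R => p.1 h - ip (K g) h)%R.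
  by apply: measurable_funB => //; exact: mev.
have mrt : measurable_fun setT (fun p : S * R => rho (p.2 - L g)).
  exact: (measurableT_comp mrho mtau).
have mgood n : measurable (good n).
  have mt : measurable_fun setT (fun t : R => t - L g)%R by exact: measurable_funB.
  rewrite (_ : good n = [set t | (0 < q n)%R] `&` ([set t | (q n < `|t - L g|)%R] `&`
    ([set t | (0 < rho (q n))%R] `&`
     [set t | (rho (t - L g) - kappa * w t < rho (q n))%R]))); last first.
    by apply/seteqP; split => t /=; [case|case=> ? [? []]].
  apply: measurableI; first exact: measurable_set_lt.
  apply: measurableI; first by apply: measurable_set_lt => //; exact: measurableT_comp.
  apply: measurableI; first exact: measurable_set_lt.
  apply: measurable_set_lt => //; apply: measurable_funB.
    exact: (measurableT_comp mrho mt).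
  by apply: measurable_funM => //; exact: measurable_normal_pdf.
have msel n : measurable (selected n).
  apply: measurableD => //; apply: bigcup_measurable => m _; exact: mgood.
rewrite (_ : [set p | _] =
  ([set p : S * R | rho (p.2 - L g) = 0%R] `&`
   [set p : S * R | (sigma * c < `|p.1 e - ip (K g) e|)%R]) `|`
  \bigcup_n ([set p : S * R | selected n p.2] `&` accepted n)); last first.
  apply/seteqP; split => -[y t] /=.
    by case=> [[? ?]|[n sn an]]; [left|right; exists n].
  by case=> [[? ?]|[n _ [sn an]]]; [left|right; exists n].
apply: measurableU.
  apply: measurableI; first exact: measurable_set_eq.
  apply: measurable_set_lt => //; apply: measurableT_comp => //; exact: mdev.
apply: bigcupT_measurable => n; apply: measurableI.
  have := @measurable_snd _ _ S R measurableT _ (msel n).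
  by rewrite setTI.
apply: measurable_set_le => //; apply: measurable_funM; last exact: mdev.
exact: (measurableT_comp measurable_sg mtau).
Qed.

Let measurable_near_optimal_section f theta :
  measurable [set v | near_optimal (Y f v) theta].
Proof.
have mA : measurable [set y | near_optimal y theta].
  rewrite (_ : [set y | _] = ysection [set p : S * R | near_optimal p.1 p.2] theta).
    exact: measurable_ysection.
  by apply/seteqP; split => x; rewrite /ysection/= inE.
by have := measurable_observation f measurableT mA; rewrite setTI.
Qed.

Let sg_sq (t : R) : t != 0%R -> (Num.sg t * Num.sg t = 1)%R.
Proof. by move=> t0; rewrite -expr2 sqr_sg t0. Qed.

Let tau_neq0 (t : R) : (0 < rho t)%R -> t != 0%R.
Proof.
move=> r0; apply/eqP => t0; move: r0; rewrite t0 ltNge => /negP; apply.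
have F0 : F 0%R.
  by have := convex_sym_half F_convex F_sym (F_hs 0) (F_hs 0); rewrite subrr scaler0.
by have := distance_le hs_min F0; rewrite !raddf0 normr0.
Qed.

Let observation_centered f h v :
  (Y f v h - ip (K g) h = ip (K (f - g)) h + sigma * eps h v)%R.
Proof. by rewrite /observation KB (ipBl ipP ipC); ring. Qed.

Let near_optimal_coverage f : F f ->
  (1 - alpha)%:E <= P [set v | near_optimal (Y f v) (L f)].
Proof.
move=> Ff; have [r0|r0] := eqVneq (rho (L f - L g)) 0%R.
  have [cov _] := two_sided_prob (ip (K (f - g)%R) e) e1 c_ge0 cE.
  apply: (le_trans cov); apply: le_measure.
  - rewrite inE; apply: measurable_set_lt => //; apply: measurableT_comp => //.
    apply: measurable_funD => //; apply: measurable_funM => //; exact: measurable_funP.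
  - by rewrite inE; exact: measurable_near_optimal_section.
  - by move=> v /= h; left; split => //; rewrite observation_centered.
have rgt0 : (0 < rho (L f - L g))%R by rewrite lt_neqAle eq_sym r0 distance_ge0.
have [n sn] := ex_selected rgt0.
have [[q0 qt rq _] _] := sn.
have s2 := sg_sq (tau_neq0 rgt0); set s := Num.sg (L f - L g) in s2 *.
have k0 : (0 < `|k n|)%R by [].
have proj : (rho (q n) ^+ 2 <= s * ip (K (f - g)) (k n))%R.
  have Fsf : F (s *: (f - g))%R.
    apply: convex_sym_scale => //; last exact: F_sub.
    by rewrite /s normr_sg; case: (_ != _).
  have qL : (q n <= L (s *: (f - g)))%R.
    by rewrite linearZ/= LB -normrEsg ltW.
  have := distance_projection ipP ipC ip_norm F_convex F_sym F_hs L_hs hs_min q0 Fsf qL.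
  by rewrite [K (_ *: _)%R]linearZ/= (ipZr ipP) ipC.
have E : P [set v | (- (sigma * z * rho (q n)) <= s * (sigma * eps (k n) v))%R] =
    (1 - alpha)%:E.
  rewrite one_sided_prob// -N_z opprK.
  have -> // : (sigma * z * rho (q n) / (sigma * `|k n|) = z)%R.
  by rewrite -[`|k n|%R]/(rho (q n)); field; rewrite !gt_eqF.
rewrite -E; apply: le_measure.
- rewrite inE; apply: measurable_set_le => //; apply: measurable_funM => //.
  by apply: measurable_funM => //; exact: measurable_funP.
- by rewrite inE; exact: measurable_near_optimal_section.
- move=> v /= h; right; exists n => //.
  by rewrite /accepted/= observation_centered -/s mulrDr; move: proj h; lra.
Qed.

Let near_optimal_length theta :
  P [set v | near_optimal (Y g v) theta] <=
  (acceptance theta)%:E + (normal_peak 1 * kappa / sigma * w theta)%:E.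
Proof.
have p0 : (0 <= normal_peak (1 : R))%R by exact: normal_peak_ge0.
have slack0 : (0 <= normal_peak 1 * kappa / sigma * w theta)%R.
  by rewrite mulr_ge0 ?divr_ge0 ?mulr_ge0// ltW.
have Kgg h v : (Y g v h - ip (K g) h = sigma * eps h v)%R.
  by rewrite observation_centered subrr raddf0 ipC (ip0r ipP) add0r.
have [r0|r0] := eqVneq (rho (theta - L g)) 0%R.
  have [_ /(_ erefl) covg] := two_sided_prob 0%R e1 c_ge0 cE.
  have -> : acceptance theta = (1 - alpha)%R by rewrite /acceptance r0 mul0r subr0.
  rewrite -covg; apply: (@le_trans _ _ (P [set v | (sigma * c < `|0 + sigma * eps e v|)%R])).
    apply: le_measure.
    - by rewrite inE; exact: measurable_near_optimal_section.
    - rewrite inE; apply: measurable_set_lt => //; apply: measurableT_comp => //.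
      apply: measurable_funD => //; apply: measurable_funM => //; exact: measurable_funP.
    - move=> v /= [[_]|[n [gn _] _]]; first by rewrite Kgg add0r.
      by have := good_rho gn; have [_ _ rq _] := gn; rewrite r0 leNgt rq.
  by rewrite leeDl.
have rgt0 : (0 < rho (theta - L g))%R by rewrite lt_neqAle eq_sym r0 distance_ge0.
have [n sn] := ex_selected rgt0.
have [gn _] := sn; have [q0 qt rq rw] := gn; have rr := good_rho gn.
have s2 := sg_sq (tau_neq0 rgt0); set s := Num.sg (theta - L g) in s2 *.
have k0 : (0 < `|k n|)%R by [].
apply: (@le_trans _ _ (normal_cdf (z - rho (q n) / sigma))%:E).
  have -> : (normal_cdf (z - rho (q n) / sigma))%:E =
      P [set v | (rho (q n) ^+ 2 - sigma * z * rho (q n) <= s * (sigma * eps (k n) v))%R].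
    rewrite one_sided_prob// normal_cdfE; congr (normal_prob _ _ _).
    apply/seteqP; split => x /=; rewrite !in_itv/= -/(rho (q n));
      (have -> : ((- (rho (q n) ^+ 2 - sigma * z * rho (q n)) / (sigma * rho (q n)) =
       z - rho (q n) / sigma)%R) by field; rewrite !gt_eqF); by [].
  apply: le_measure.
  - by rewrite inE; exact: measurable_near_optimal_section.
  - rewrite inE; apply: measurable_set_le => //; apply: measurable_funM => //.
    by apply: measurable_funM => //; exact: measurable_funP.
  - move=> v /= [[rz _]|[m sm am]]; first by rewrite rz eqxx in r0.
    by move: am; rewrite -(selected_uniq sn sm) /accepted/= Kgg.
rewrite -EFinD lee_fin /acceptance.
have le1 : (z - rho (theta - L g) / sigma <= z - rho (q n) / sigma)%R.
  by rewrite lerD2l lerN2 ler_pM2r ?invr_gt0.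
apply: (le_trans (normal_cdf_lipschitz le1)); rewrite lerD2l.
have -> : (normal_peak 1 * kappa / sigma * w theta =
  normal_peak 1 * (kappa * w theta / sigma))%R.
  by ring.
rewrite ler_wpM2l//.
have -> : (z - rho (q n) / sigma - (z - rho (theta - L g) / sigma) =
  (rho (theta - L g) - rho (q n)) / sigma)%R by ring.
by rewrite ler_pM2r ?invr_gt0//; lra.
Qed.

Lemma near_optimal_confidence_set : exists C : S -> set R,
  confidence_sets ip F K L sigma eps alpha C /\
  expected_length ip K sigma eps g C <=
    \int[mu]_theta (acceptance theta)%:E + (normal_peak 1 * kappa / sigma)%:E.
Proof.
exists near_optimal; split.
  split; first exact: measurable_near_optimal.
  by apply: le_ereal_inf_tmp => _ [f Ff <-]; exact: near_optimal_coverage.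
have r0 : (0 <= normal_peak 1 * kappa / sigma)%R.
  by rewrite divr_ge0 ?mulr_ge0 ?normal_peak_ge0// ltW.
have mw : measurable_fun setT (fun theta => (w theta)%:E).
  by apply/measurable_EFinP; exact: measurable_normal_pdf.
have macc : measurable_fun setT (fun theta => (acceptance theta)%:E).
  by apply/measurable_EFinP; exact: measurable_acceptance.
rewrite expected_length_sections//.
apply: (@le_trans _ _ (\int[mu]_theta ((acceptance theta)%:E +
    (normal_peak 1 * kappa / sigma)%:E * (w theta)%:E))).
  apply: ge0_le_integral => //.
  - have := measurable_fun_ysection P (measurable_observed_set measurable_near_optimal).
    congr (measurable_fun _ _); apply/funext => theta /=; congr (P _).
    by apply/seteqP; split => x; rewrite /ysection/= inE.
  - by apply: emeasurable_funD => //; exact: emeasurable_funM.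
rewrite ge0_integralD//; last 3 first.
- by move=> theta _; rewrite lee_fin fine_ge0.
- by move=> theta _; rewrite mule_ge0// lee_fin// ltW.
- exact: emeasurable_funM.
rewrite ge0_integralZl//; last by move=> theta _; rewrite lee_fin ltW.
by rewrite integral_normal_pdf mule1.
Qed.

End near_optimal_set.

Lemma best_expected_lengthE : best_expected_length ip F K L sigma eps alpha g =
  \int[mu]_theta (acceptance theta)%:E.
Proof.
apply/le_anti/andP; split; last first.
  by apply: le_ereal_inf_tmp => _ [C CI <-]; exact: expected_length_lower_bound.
have [e e1] := unit_vector.
have [c c0 cE] := normal_two_sided_critical alpha_gt0 alpha_lt1.
apply/lee_addgt0Pr => x x0.
have p0 : (0 < normal_peak (1 : R))%R by exact: normal_peak_gt0.
have kappa0 : (0 < x * sigma / normal_peak 1)%R by rewrite divr_gt0// mulr_gt0.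
have [C [CI lenC]] := near_optimal_confidence_set e1 (ltW c0) cE kappa0.
apply: (@le_trans _ _ (expected_length ip K sigma eps g C)).
  by apply: ereal_inf_lbound; exists C.
apply: (le_trans lenC); rewrite leeD2l// lee_fin.
by rewrite le_eqVlt; apply/orP; left; apply/eqP; field; rewrite !gt_eqF.
Qed.

End expected_length_bounds.

Section modulus_slope.
Context {R : realType} {V : lmodType R} {H : normedModType R}.
Context (F : set V) (K : V -> H) (L : V -> R).

Lemma modulus_homo (x y : R) : (x <= y)%R -> modulus F K L x <= modulus F K L y.
Proof.
move=> xy; apply: le_ereal_sup => _ [p [px Fp] <-].
by exists p => //; split => //; exact: le_trans px xy.
Qed.

Lemma superdifferential_ge0 (delta s : R) (f g : V) : (0 < delta)%R ->
  modulus_maximizer F K L delta f g ->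
  superdifferential (modulus F K L) delta s -> (0 <= s)%R.
Proof.
move=> d0 [_ _ _ fg] /(_ (delta + 1)%R) H1.
have /H1 : (0 < delta + 1)%R by rewrite addr_gt0.
rewrite (_ : delta + 1 - delta = 1)%R ?mulr1; last by ring.
move=> le1.
have le2 : modulus F K L delta <= modulus F K L delta + s%:E.
  by apply: le_trans le1; apply: modulus_homo; lra.
by move: le2; rewrite -fg -EFinD lee_fin lerDl.
Qed.

End modulus_slope.

Theorem corollary3p3
  (R : realType) (V : lmodType R)
  (H : completeNormedModType R) (ip : {dot H for idfun})
  (hip : forall h : H, ip h h = (`|h| ^+ 2)%R)
  (F : set V) (F_convex : convex_set (F : set (convex_lmodType V)))
  (K : {linear V -> H}) (L : {scalar V})
  (sigma : R) (sigma_gt0 : (0 < sigma)%R)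
  (alpha : R) (alpha_gt0 : (0 < alpha)%R) (alpha_lt1 : (alpha < 1)%R)
  (d : measure_display) (Omega : measurableType d) (P : probability Omega R)
  (eps : H -> {RV P >-> R}) (eps_gauss : standard_gaussian eps)
  (fs gs : R -> V)
  (fgs_max : forall delta : R, (0 < delta)%R ->
     modulus_maximizer F K L delta (fs delta) (gs delta))
  (dw : R -> R)
  (dw_super : forall delta : R, (0 < delta)%R ->
     superdifferential (modulus F K L) delta (dw delta))
  (dw_neq0 : forall delta : R, (0 < delta)%R -> dw delta != 0%R)
  (delta_chi : R) (delta_chi_gt0 : (0 < delta_chi)%R)
  (delta_chi_min : forall delta : R, (0 < delta)%R ->
     (chi F K L sigma alpha dw delta_chi <= chi F K L sigma alpha dw delta)%R)
  (g : V) (gF : F g)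
  (minimizer : forall L0 : R, exists f : V, [/\ F f, L f = L0 &
     forall f' : V, F f' -> L f' = L0 -> (`|K (g - f)| <= `|K (g - f')|)%R])
  (F_sym : forall f : V, F f -> F (- f)%R)
  (F_sub : forall f : V, F f -> F (f - g)%R)
  (d' : measure_display) (Omega' : measurableType d') (P' : probability Omega' R)
  (Z : {RV P' >-> R})
  (Z_normal : forall B : set R, measurable B ->
     distribution P' Z B = normal_prob (0%R : R) 1%R B) :
  efficiency ip F K L sigma eps alpha g
    (flci ip F K L sigma alpha dw fs gs delta_chi) =
  best_expected_length ip F K L sigma eps alpha g /
    (2 * chi F K L sigma alpha dw delta_chi)%:E
  /\
  best_expected_length ip F K L sigma eps alpha g /
    (2 * chi F K L sigma alpha dw delta_chi)%:E =
  ((1 - alpha)%:E *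
     cond_mean P' [set w | (Z w <= z_quantile (1 - alpha))%R]
       (fun w => modulus F K L (2 * sigma * (z_quantile (1 - alpha) - Z w))%R)) /
  (2 * cv alpha (fine (modulus F K L delta_chi) / (2 * sigma * dw delta_chi)
                 - delta_chi / (2 * sigma))
     * (sigma * dw delta_chi))%:E.
Proof.
have ipP (a : R) (h k l : H) : (ip l (a *: h + k) = a * ip l h + ip l k)%R.
  by rewrite linearDr linearZr_LR.
have ipC (h k : H) : ip h k = ip k h.
  by rewrite hermC/= expr0 mul1r.
have F_add f : F f -> F (g + f)%R.
  by move=> Ff; have := F_sym _ (F_sub _ (F_sym _ Ff)); rewrite opprB opprK.
have modulus_attained (delta : R) : (0 < delta)%R ->
    exists f g, modulus_maximizer F K L delta f g.
  by move=> d0; exists (fs delta), (gs delta); exact: fgs_max.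
have minimizer0 tau : exists h0, [/\ F h0, L h0 = tau &
    forall h, F h -> L h = tau -> (`|K h0| <= `|K h|)%R].
  have [f [Ff Lf fmin]] := minimizer (L g + tau)%R.
  exists (f - g)%R; split; first exact: F_sub.
    by rewrite raddfB/= Lf addrC addKr.
  move=> h Fh Lh; have := fmin _ (F_add _ Fh).
  rewrite raddfD/= Lh => /(_ erefl).
  by rewrite opprD addrA subrr sub0r !raddfN normrN -opprB raddfN normrN.
have [hs hsP] := choice minimizer0.
have F_hs tau : F (hs tau) by have [] := hsP tau.
have L_hs tau : L (hs tau) = tau by have [] := hsP tau.
have hs_min h : F h -> (`|K (hs (L h))| <= `|K h|)%R.
  by move=> Fh; have [_ _] := hsP (L h); exact.
have chi_ge0 : (0 <= chi F K L sigma alpha dw delta_chi)%R.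
  rewrite mulr_ge0 ?cv_ge0// mulr_ge0 ?(ltW sigma_gt0)//.
  exact: (superdifferential_ge0 delta_chi_gt0 (fgs_max _ delta_chi_gt0)
    (dw_super _ delta_chi_gt0)).
have lengthE : expected_length ip K sigma eps g
    (flci ip F K L sigma alpha dw fs gs delta_chi) =
    (2 * chi F K L sigma alpha dw delta_chi)%:E.
  set x := chi _ _ _ _ _ _ _ in chi_ge0 *.
  rewrite /expected_length (eq_integral (cst (2 * x)%:E)); last first.
    move=> w _; rewrite lebesgue_measure_itv/= lte_fin -EFinB.
    by case: ltP => h; congr EFin; rewrite -/x in h *; lra.
  rewrite integral_cst// -[RHS]mule1; congr (_ * _); exact: probability_setT.
split; first by rewrite /efficiency lengthE.
have a0 : (0 < 1 - alpha)%R by rewrite subr_gt0.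
rewrite (best_expected_lengthE ipP ipC hip F_convex F_sym modulus_attained F_hs
  L_hs hs_min F_sub sigma_gt0 alpha_gt0 alpha_lt1 eps_gauss).
congr (_ / _%:E); last by rewrite /chi mulrA.
rewrite /cond_mean (modulus_integral F_convex F_sym modulus_attained F_hs L_hs
  hs_min g alpha sigma_gt0 Z_normal).
have -> : P' [set w | (Z w <= z_quantile (1 - alpha))%R] = (1 - alpha)%:E.
  transitivity (distribution P' Z `]-oo, z_quantile (1 - alpha)]); first
    by congr (P' _); apply/seteqP; split => w /=; rewrite in_itv.
  by rewrite Z_normal// -normal_cdfE normal_cdf_z_quantile// gtrBl.
rewrite inver gt_eqF// muleC -muleA -EFinM mulVf ?gt_eqF// mule1.
by [].
Qed.
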